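(* Let $\mathcal{E}:\mathcal{C}_{2n}\to\mathcal{C}_{2n}$ be a Gaussian map given by $$\mathcal{E}(X)(\theta)=C\int\exp\left[S(\theta,\eta)+i\eta^T\mu\right]X(\mu)\,D\eta\,D\mu,\qquad S(\theta,\eta)=\frac{i}{2}(\theta^T,\eta^T)\begin{pmatrix}A&B\\-B^T&D\end{pmatrix}\begin{pmatrix}\theta\\\eta\end{pmatrix},$$ with $A,B,D$ complex $2n\times2n$ matrices, $A,D$ antisymmetric, and $C\in\mathbb{C}$. (a) $\mathcal{E}$ is trace preserving if and only if $D=0$ and $C=1$. In this case, a Gaussian operator of nonzero trace with correlation matrix $M$ is mapped to a Gaussian operator with correlation matrix $\mathcal{E}(M)=BMB^T+A$. (b) $\mathcal{E}$ is bistochastic if and only if $A=D=0$ and $C=1$. In this case, a Gaussian operator of nonzero trace with correlation matrix $M$ is mapped to a Gaussian operator with correlation matrix $\mathcal{E}(M)=BMB^T$.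
   Context: $\mathcal{C}_{2n}$ is the complex unital algebra generated by Hermitian $\hat c_1,\dots,\hat c_{2n}$ with $\hat c_a\hat c_b+\hat c_b\hat c_a=2\delta_{ab}\hat I$; it is identified with the algebra of all linear operators on the $2^n$-dimensional Fock space of $n$ fermionic modes, with its usual trace (so $\mathrm{Tr}(\hat I)=2^n$ and non-trivial ordered monomials are traceless). The Grassmann representation $X(\theta)$ of $X\in\mathcal{C}_{2n}$ is the image of $X$ under the linear isomorphism from $\mathcal{C}_{2n}$ to the complex Grassmann (exterior) algebra $\mathcal{G}_{2n}$ with anticommuting generators $\theta_1,\dots,\theta_{2n}$ sending $\hat I\mapsto1$ and $\hat c_{a_1}\cdots\hat c_{a_p}\mapsto\theta_{a_1}\cdots\theta_{a_p}$ for $a_1<\dots<a_p$; $X(\mu)$ is the same polynomial in anticommuting variables $\mu_1,\dots,\mu_{2n}$. The variables $\theta_a,\eta_a,\mu_a$ ($a=1,\dots,2n$) are $6n$ mutually anticommuting Grassmann generators. $\theta^TN\theta=\sum_{a,b}N_{ab}\theta_a\theta_b$, $\eta^T\mu=\sum_a\eta_a\mu_a$, and likewise for other forms; exponentials are finite Taylor series. Partial derivatives are left derivatives: $\partial_{\theta_a}1=0$, $\partial_{\theta_a}(\theta_bf)=\delta_{ab}f-\theta_b\partial_{\theta_a}f$. Berezin integration is $\int d\theta_a=\partial/\partial\theta_a$, $\int D\theta=\int d\theta_{2n}\cdots\int d\theta_1$, so $\int D\theta\,\theta_1\cdots\theta_{2n}=1$. An operator $X$ with $\mathrm{Tr}(X)\ne0$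 is Gaussian with correlation matrix $M$ iff $X(\theta)=C_X\exp\left(\frac{i}{2}\theta^TM\theta\right)$ for some $C_X\in\mathbb{C}$ and the complex antisymmetric $2n\times2n$ matrix $M$. $\mathcal{E}$ is trace preserving if $\mathrm{Tr}\,\mathcal{E}(X)=\mathrm{Tr}\,X$ for all $X\in\mathcal{C}_{2n}$; it is bistochastic if it is trace preserving and $\mathcal{E}(\hat I)=\hat I$. *)

(* Defs.v *)
(* Fermionic Gaussian maps over the Clifford algebra C_{2n}, in Grassmann
   representation.  Everything is stated over an arbitrary numClosedFieldType
   (or field); the theorem instantiates it with the complex numbers R[i].      *)
From HB Require Import structures.
From mathcomp Require Import all_boot all_order all_algebra.
From mathcomp Require Import ring.

Set Implicit Arguments.
Unset Strict Implicit.
Unset Printing Implicit Defensive.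

Import Order.TTheory GRing.Theory Num.Theory.
Local Open Scope ring_scope.

(* The Grassmann (exterior) algebra over F with N anticommuting generators.
   An element is the family of its coefficients in the basis of ordered
   monomials x_{i_1} ... x_{i_p}, i_1 < ... < i_p, indexed by {i_1, ..., i_p}. *)
Definition grassmann (F : fieldType) (N : nat) : Type := {ffun {set 'I_N} -> F^o}.

HB.instance Definition _ (F : fieldType) N :=
  Vector.copy (grassmann F N) {ffun {set 'I_N} -> F^o}.

Section GrassmannAlgebra.
Variables (F : fieldType) (N : nat).
Implicit Types (S T U V : {set 'I_N}) (f g h : grassmann F N).

Definition gcoef S f : F^o := (f : {ffun {set 'I_N} -> F^o}) S.

Definition gbasis S : grassmann F N := [ffun T => (T == S)%:R : F^o].

(* Number of transpositions needed to sort x_T x_U, for disjoint T and U. *)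
Definition ginv T U : nat := (\sum_(i in T) \sum_(j in U) (j < i))%N.

Definition gsign T U : F := if [disjoint T & U] then (-1) ^+ ginv T U else 0.

Definition gmul f g : grassmann F N :=
  \sum_T \sum_U (gcoef T f * gcoef U g * gsign T U) *: gbasis (T :|: U).

Lemma gcoefP f g : (forall S, gcoef S f = gcoef S g) -> f = g.
Proof. by move=> e; apply/ffunP => S; apply: e. Qed.

Lemma gcoef_is_linear S : linear (gcoef S).
Proof. by move=> a f g; rewrite /gcoef [LHS]ffunE; congr (_ + _); rewrite ffunE. Qed.
HB.instance Definition _ S :=
  GRing.isLinear.Build F (grassmann F N) F^o _ (gcoef S) (gcoef_is_linear S).

Lemma gcoef_sum I (r : seq I) P (E : I -> grassmann F N) S :
  gcoef S (\sum_(i <- r | P i) E i) = \sum_(i <- r | P i) gcoef S (E i).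
Proof. exact: raddf_sum. Qed.
Lemma gcoefD f g S : gcoef S (f + g) = gcoef S f + gcoef S g.
Proof. exact: raddfD. Qed.
Lemma gcoefZ a f S : gcoef S (a *: f) = a * gcoef S f.
Proof. exact: linearZ. Qed.
Lemma gcoef_basis S T : gcoef T (gbasis S) = (T == S)%:R.
Proof. by rewrite /gcoef ffunE. Qed.

Lemma grassmannE f : f = \sum_S gcoef S f *: gbasis S.
Proof.
apply: gcoefP => S; rewrite gcoef_sum (bigD1 S) //= gcoefZ gcoef_basis eqxx mulr1.
rewrite big1 ?addr0 // => T nTS.
by rewrite gcoefZ gcoef_basis eq_sym (negbTE nTS) mulr0.
Qed.

Lemma big_disjU T U (E : 'I_N -> nat) : [disjoint T & U] ->
  (\sum_(i in T :|: U) E i = \sum_(i in T) E i + \sum_(i in U) E i)%N.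
Proof. by move=> dTU; rewrite -bigU //; apply: eq_bigl => i; rewrite !inE. Qed.

Lemma ginvUl T U V : [disjoint T & U] -> ginv (T :|: U) V = (ginv T V + ginv U V)%N.
Proof. by move=> dTU; rewrite /ginv big_disjU. Qed.

Lemma ginvUr T U V : [disjoint U & V] -> ginv T (U :|: V) = (ginv T U + ginv T V)%N.
Proof.
by move=> dTU; rewrite /ginv -big_split; apply: eq_bigr => i _; rewrite big_disjU.
Qed.

Lemma disjointsUl T U V :
  [disjoint T :|: U & V] = [disjoint T & V] && [disjoint U & V].
Proof. by rewrite -!setI_eq0 setIUl setU_eq0. Qed.

Lemma gsignA T U V : gsign U V * gsign T (U :|: V) = gsign T U * gsign (T :|: U) V.
Proof.
rewrite /gsign [[disjoint T & U :|: V]]disjoint_sym !disjointsUl.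
rewrite [[disjoint U & T]]disjoint_sym [[disjoint V & T]]disjoint_sym.
have [dUV|] := boolP [disjoint U & V]; last by rewrite andbF mul0r mulr0.
have [dTU|] := boolP [disjoint T & U]; last by rewrite mulr0 mul0r.
have [dTV|] /= := boolP [disjoint T & V]; last by rewrite !mulr0.
rewrite -!exprD; congr (_ ^+ _).
by rewrite ginvUl // ginvUr // [LHS]addnC addnA.
Qed.

Lemma gcoefM f g S : gcoef S (gmul f g) =
  \sum_T \sum_U gcoef T f * gcoef U g * gsign T U * (S == T :|: U)%:R.
Proof.
rewrite gcoef_sum; apply: eq_bigr => T _; rewrite gcoef_sum.
by apply: eq_bigr => U _; rewrite gcoefZ gcoef_basis.
Qed.

Lemma gmulDl : left_distributive gmul +%R.
Proof.
move=> f g h; rewrite /gmul -big_split; apply: eq_bigr => T _.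
by rewrite -big_split; apply: eq_bigr => U _; rewrite gcoefD !mulrDl scalerDl.
Qed.

Lemma gmulDr : right_distributive gmul +%R.
Proof.
move=> f g h; rewrite /gmul -big_split; apply: eq_bigr => T _.
by rewrite -big_split; apply: eq_bigr => U _; rewrite gcoefD mulrDr mulrDl scalerDl.
Qed.

Lemma gmulZl a f g : a *: gmul f g = gmul (a *: f) g.
Proof.
rewrite /gmul scaler_sumr; apply: eq_bigr => T _.
by rewrite scaler_sumr; apply: eq_bigr => U _; rewrite gcoefZ scalerA !mulrA.
Qed.

Lemma gmulZr a f g : a *: gmul f g = gmul f (a *: g).
Proof.
rewrite /gmul scaler_sumr; apply: eq_bigr => T _.
rewrite scaler_sumr; apply: eq_bigr => U _; rewrite gcoefZ scalerA.
by rewrite !mulrA [_ * a]mulrC.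
Qed.

Lemma sum_delta (I : finType) (i0 : I) (E : I -> F) :
  \sum_i E i * (i == i0)%:R = E i0.
Proof.
rewrite (bigD1 i0) //= eqxx mulr1 big1 ?addr0 // => i ne.
by rewrite (negbTE ne) mulr0.
Qed.

Lemma gmul_basis T U : gmul (gbasis T) (gbasis U) = gsign T U *: gbasis (T :|: U).
Proof.
apply: gcoefP => S; rewrite gcoefM gcoefZ gcoef_basis.
under eq_bigr => T' _.
  under eq_bigr => U' _ do
    rewrite !gcoef_basis -!mulrA [(U' == U)%:R * _]mulrC !mulrA.
  rewrite sum_delta -!mulrA [(T' == T)%:R * _]mulrC.
  over.
by rewrite sum_delta.
Qed.

Lemma gmul_suml I (r : seq I) P (E : I -> grassmann F N) g :
  gmul (\sum_(i <- r | P i) E i) g = \sum_(i <- r | P i) gmul (E i) g.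
Proof.
elim/big_rec2: _ => [|i y x _ <-]; last by rewrite gmulDl.
by have := gmulZl 0 0 g; rewrite !scale0r => <-.
Qed.

Lemma gmul_sumr I (r : seq I) P (E : I -> grassmann F N) g :
  gmul g (\sum_(i <- r | P i) E i) = \sum_(i <- r | P i) gmul g (E i).
Proof.
elim/big_rec2: _ => [|i y x _ <-]; last by rewrite gmulDr.
by have := gmulZr 0 g 0; rewrite !scale0r => <-.
Qed.

Lemma gmulA : associative gmul.
Proof.
move: gmul gmulZl gmulZr gmul_suml gmul_sumr gmul_basis.
move=> mul mulZl mulZr mul_suml mul_sumr mul_basis f g h.
rewrite [f]grassmannE !mul_suml; apply: eq_bigr => T _.
rewrite [g]grassmannE !(mul_suml, mul_sumr); apply: eq_bigr => U _.
rewrite [h]grassmannE !mul_sumr; apply: eq_bigr => V _.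
rewrite -!(mulZl, mulZr) !mul_basis -!(mulZl, mulZr) !mul_basis !scalerA.
rewrite setUA; congr (_ *: _); rewrite -mulrA gsignA !mulrA.
by congr (_ * _ * _); rewrite mulrC mulrA.
Qed.

Lemma gmul1l : left_id (gbasis set0) gmul.
Proof.
move=> f; rewrite [f]grassmannE gmul_sumr; apply: eq_bigr => S _.
rewrite -gmulZr gmul_basis set0U /gsign disjoints_subset sub0set.
by rewrite /ginv big_set0 expr0 scale1r.
Qed.

Lemma gmul1r : right_id (gbasis set0) gmul.
Proof.
move=> f; rewrite [f]grassmannE gmul_suml; apply: eq_bigr => S _.
rewrite -gmulZl gmul_basis setU0 /gsign disjoint_sym disjoints_subset sub0set.
by rewrite /ginv big1 ?expr0 ?scale1r // => i _; rewrite big_set0.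
Qed.

Lemma gone_neq0 : gbasis set0 != 0.
Proof.
apply/eqP => e; have /eqP := gcoef_basis set0 set0.
by rewrite e eqxx /gcoef ffunE eq_sym oner_eq0.
Qed.

HB.instance Definition _ := GRing.Zmodule_isNzRing.Build (grassmann F N)
  gmulA gmul1l gmul1r gmulDl gmulDr gone_neq0.
HB.instance Definition _ :=
  GRing.Lmodule_isLalgebra.Build F (grassmann F N) gmulZl.
HB.instance Definition _ :=
  GRing.Lalgebra_isAlgebra.Build F (grassmann F N) gmulZr.

Definition gvar (i : 'I_N) : grassmann F N := gbasis [set i].

(* Left derivative with respect to the i-th generator: on a monomial containing
   it, move the generator to the front and erase it.                          *)
Definition gderiv (i : 'I_N) (f : grassmann F N) : grassmann F N :=
  \sum_(S : {set 'I_N} | i \in S)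
    ((-1) ^+ #|[set j in S | (j < i)%N]| * gcoef S f) *: gbasis (S :\ i).

(* \int d x_{i_k} ... \int d x_{i_1} for s = [:: i_1; ...; i_k]; the integral
   over the first element of s is performed first.                            *)
Definition berezin (s : seq 'I_N) (f : grassmann F N) : grassmann F N :=
  foldl (fun g i => gderiv i g) f s.

(* Taylor polynomial of order N; the remaining terms vanish for any argument
   without constant term, since a product of N + 1 such elements is zero.      *)
Definition gexp (f : grassmann F N) : grassmann F N :=
  \sum_(k < N.+1) (k`!%:R)^-1 *: f ^+ k.

(* x^T M x = sum_{a,b} M_ab x_a x_b for a column vector x of Grassmann elements. *)
Definition gquad m (x : 'cV[grassmann F N]_m) (M : 'M[F]_m) : grassmann F N :=
  \sum_a \sum_b M a b *: (x a 0 * x b 0).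

Definition gdot m (x y : 'cV[grassmann F N]_m) : grassmann F N :=
  \sum_a x a 0 * y a 0.

(* Sanity checks: defining relations of the generators, ordered monomials are
   the basis elements, and the recursive rules for the left derivative.        *)

Lemma gvarM_anticomm i j : gvar i * gvar j = - (gvar j * gvar i).
Proof.
rewrite /gvar ![_ * _]gmul_basis setUC /gsign disjoint_sym -scaleNr.
congr (_ *: _); case: ifPn => [|_]; last by rewrite oppr0.
rewrite disjoints1 inE /ginv !big_set1 => ne.
have := ne; rewrite -val_eqE /= neq_ltn.
by case/orP => lt; rewrite lt ltnNge ltnW // ?expr1 ?expr0 ?opprK.
Qed.

Lemma gvar_sqr0 i : gvar i * gvar i = 0.
Proof.
by rewrite [_ * _]gmul_basis /gsign -setI_eq0 setIid -cards_eq0 cards1 scale0r.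
Qed.

Lemma gprod_sorted (s : seq 'I_N) : sorted (fun i j : 'I_N => (i < j)%N) s ->
  \prod_(i <- s) gvar i = gbasis [set i in s].
Proof.
have tr : transitive (fun i j : 'I_N => (i < j)%N) by move=> ? ? ?; apply: ltn_trans.
elim: s => [_|i s IH] /=.
  by rewrite big_nil; congr gbasis; apply/setP => x; rewrite !inE.
rewrite (path_sortedE tr) => /andP[/allP lts /IH e].
rewrite big_cons e [_ * _]gmul_basis set_cons /gsign disjoints1 inE.
case: ifPn => [_|/negPn/lts]; last by rewrite ltnn.
rewrite /ginv big_set1 big1 ?expr0 ?scale1r // => j.
by rewrite inE => /lts lt; rewrite ltnNge ltnW.
Qed.

Lemma sorted_enum_set S : sorted (fun i j : 'I_N => (i < j)%N) (enum S).
Proof.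
have tr : transitive (fun i j : 'I_N => (i < j)%N) by move=> ? ? ?; apply: ltn_trans.
rewrite {1}/enum_mem -enumT; apply: sorted_filter => //.
have := iota_ltn_sorted 0 N; rewrite -val_enum_ord sorted_map.
by apply: sub_sorted.
Qed.

Lemma gprod_enum S : \prod_(i <- enum S) gvar i = gbasis S.
Proof.
rewrite gprod_sorted ?sorted_enum_set //; congr gbasis.
by apply/setP => x; rewrite inE mem_enum.
Qed.

Lemma gderiv_is_linear i : linear (gderiv i).
Proof.
move=> a f g; rewrite /gderiv scaler_sumr -big_split; apply: eq_bigr => S _.
by rewrite gcoefD gcoefZ mulrDr scalerDl scalerA mulrCA.
Qed.
HB.instance Definition _ i := GRing.isLinear.Build F (grassmann F N)
  (grassmann F N) _ (gderiv i) (gderiv_is_linear i).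

Lemma gderivZ i a f : gderiv i (a *: f) = a *: gderiv i f.
Proof. exact: linearZ. Qed.

Lemma gderiv_basis i S : gderiv i (gbasis S) =
  if i \in S then (-1) ^+ #|[set j in S | (j < i)%N]| *: gbasis (S :\ i) else 0.
Proof.
rewrite /gderiv big_mkcond (bigD1 S) //= big1 ?addr0 => [|T ne].
  by rewrite gcoef_basis eqxx mulr1.
by rewrite gcoef_basis (negbTE ne) mulr0 scale0r if_same.
Qed.

Lemma gderiv1 i : gderiv i 1 = 0.
Proof. by rewrite gderiv_basis inE. Qed.

Lemma card_ltE i S : #|[set k in S | (k < i)%N]| = (\sum_(k in S) (k < i))%N.
Proof.
rewrite -sum1_card big_mkcond [RHS]big_mkcond; apply: eq_bigr => k _.
by rewrite inE; case: (k \in S); case: (k < i)%N.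
Qed.

Lemma card_ltU1 i j S : j \notin S ->
  #|[set k in j |: S | (k < i)%N]| = ((j < i) + #|[set k in S | (k < i)%N]|)%N.
Proof. by move=> nS; rewrite !card_ltE big_setU1. Qed.

Lemma gvarM_basis j S : gvar j * gbasis S =
  if j \in S then 0
  else (-1) ^+ #|[set k in S | (k < j)%N]| *: gbasis (j |: S).
Proof.
rewrite [_ * _]gmul_basis /gsign disjoints1.
case: (boolP (j \in S)) => _ /=; first by rewrite scale0r.
by rewrite /ginv big_set1 card_ltE.
Qed.

Lemma gderivM i j f :
  gderiv i (gvar j * f) = (i == j)%:R *: f - gvar j * gderiv i f.
Proof.
rewrite [f]grassmannE mulr_sumr !(linear_sum (gderiv i)) /= scaler_sumr mulr_sumr -sumrB.
apply: eq_bigr => S _.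
rewrite -scalerAr !gderivZ -scalerAr scalerA mulrC -scalerA -scalerBr.
congr (_ *: _); rewrite gvarM_basis gderiv_basis.
have [<-|nij] := eqVneq i j.
  case: ifP => iS; last first.
    rewrite gderivZ gderiv_basis setU11 mulr0 subr0 card_ltU1 ?iS //.
    by rewrite ltnn scalerA -exprD addnn -signr_odd odd_double setU1K ?iS.
  rewrite (linear0 (gderiv i)) -scalerAr gvarM_basis setD11 setD1K // scalerA -exprD.
  rewrite -{2}(setD1K iS) card_ltU1 ?setD11 // ltnn addnn -signr_odd.
  by rewrite odd_double subrr.
rewrite scale0r sub0r; have [iS|iS] := boolP (i \in S); last first.
  case: ifP => [_|jS]; first by rewrite (linear0 (gderiv i)) mulr0 oppr0.
  by rewrite gderivZ gderiv_basis !inE (negbTE nij) (negbTE iS) scaler0 mulr0 oppr0.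
rewrite -scalerAr gvarM_basis !inE eq_sym nij /=.
case: ifP => [_|jS]; first by rewrite (linear0 (gderiv i)) scaler0 oppr0.
rewrite gderivZ gderiv_basis !inE iS orbT card_ltU1 ?jS //.
have -> : (j |: S) :\ i = j |: (S :\ i).
  by apply/setP => k; rewrite !inE; case: (eqVneq k j) => // ->; rewrite eq_sym nij.
rewrite !scalerA -!exprD -scaleNr -[- (_ ^+ (_ + _))]mulN1r -exprS; congr (_ *: _).
have -> : #|[set k in S | (k < j)%N]| = ((i < j) + #|[set k in S :\ i | (k < j)%N]|)%N.
  by rewrite -{1}(setD1K iS) card_ltU1 ?setD11.
have : ((i < j) + (j < i) = 1)%N.
  by have := nij; rewrite -val_eqE /= neq_ltn; case: ltngtP.
by move=> e; congr (_ ^+ _); rewrite addnACA e add1n addnC.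
Qed.

Lemma berezin_top : berezin (enum 'I_N) (\prod_(i <- enum 'I_N) gvar i) = 1.
Proof.
suff H s : sorted (fun i j : 'I_N => (i < j)%N) s ->
    berezin s (\prod_(i <- s) gvar i) = 1.
  by apply: H; have := iota_ltn_sorted 0 N; rewrite -val_enum_ord sorted_map.
elim: s => [_|i s IH ss] /=; first by rewrite big_nil.
have tr : transitive (fun i j : 'I_N => (i < j)%N) by move=> ? ? ?; apply: ltn_trans.
have := ss; rewrite /= (path_sortedE tr) => /andP[/allP lts {}ss].
rewrite big_cons gderivM eqxx scale1r gprod_sorted // gderiv_basis inE.
case: ifP => [/lts|_]; first by rewrite ltnn.
by rewrite mulr0 subr0 -gprod_sorted // IH.
Qed.

End GrassmannAlgebra.

(* f(x): the polynomial f in m anticommuting variables, with x_1, ..., x_m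
   substituted for the variables (enum S lists S in increasing order).         *)
Definition gsubst (F : fieldType) N m (f : grassmann F m)
    (x : 'cV[grassmann F N]_m) : grassmann F N :=
  \sum_S gcoef S f *: \prod_(a <- enum S) x a 0.

Section FermionicGaussian.
Variables (C : numClosedFieldType) (n : nat).
Implicit Types (c : 'I_(2 * n) -> 'M[C]_(2 ^ n)) (X : 'M[C]_(2 ^ n)).

(* Operators on the 2^n-dimensional Fock space are 2^n x 2^n matrices; c lists
   the 2n Hermitian generators of the Clifford algebra.  Such a family always
   generates the whole matrix algebra (see grassmann_repK below).              *)
Definition clifford_generators c : Prop :=
  (forall a, c a \is hermsymmx) /\
  (forall a b, c a *m c b + c b *m c a = (2 * (a == b)%:R)%:M).

Definition clifford_monomial c (S : {set 'I_(2 * n)}) : 'M[C]_(2 ^ n) :=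
  \prod_(a <- enum S) c a.

(* The linear map with 1 |-> I and x_{a_1}...x_{a_p} |-> c_{a_1}...c_{a_p} for
   a_1 < ... < a_p; the Grassmann representation is its inverse.               *)
Definition clifford_of c (f : grassmann C (2 * n)) : 'M[C]_(2 ^ n) :=
  \sum_S gcoef S f *: clifford_monomial c S.

Lemma clifford_of_is_linear c : linear (clifford_of c).
Proof.
move=> a f g; rewrite /clifford_of scaler_sumr -big_split; apply: eq_bigr => S _.
by rewrite gcoefD gcoefZ scalerDl scalerA.
Qed.
HB.instance Definition _ c := GRing.isLinear.Build C (grassmann C (2 * n))
  'M[C]_(2 ^ n) _ (clifford_of c) (clifford_of_is_linear c).

Definition grassmann_rep c : 'M[C]_(2 ^ n) -> grassmann C (2 * n) :=
  (linfun (clifford_of c))^-1%VF.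

Lemma clifford_of_basis c S : clifford_of c (gbasis C S) = clifford_monomial c S.
Proof.
rewrite /clifford_of (bigD1 S) //= gcoef_basis eqxx scale1r big1 ?addr0 // => T ne.
by rewrite gcoef_basis (negbTE ne) scale0r.
Qed.

Section Isomorphism.
Variables (c : 'I_(2 * n) -> 'M[C]_(2 ^ n)) (cP : clifford_generators c).

Let c_sqr a : c a * c a = 1.
Proof.
have [_ /(_ a a)] := cP; rewrite eqxx mulr1 => e.
have n2 : (2 : C) != 0 by rewrite pnatr_eq0.
by apply: (scalerI n2); rewrite scaler_nat mulr2n [LHS]e -scalemx1.
Qed.

Let c_anti a b : a != b -> c a * c b = - (c b * c a).
Proof.
have [_ /(_ a b)] := cP; move=> + /negbTE ne; rewrite ne mulr0 raddf0 => /addr0_eq e.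
by rewrite -[c b * c a]e opprK.
Qed.

Let mxAl k (u v : 'M[C]_(2 ^ n)) : (k *: u) * v = k *: (u * v).
Proof. by symmetry; apply: scalemxAl. Qed.

Let mxAr k (u v : 'M[C]_(2 ^ n)) : u * (k *: v) = k *: (u * v).
Proof. by symmetry; apply: scalemxAr. Qed.

Let chi a (S : {set 'I_(2 * n)}) : C := (-1) ^+ (#|S| + (a \in S)).

Let chi_sqr a S : chi a S * chi a S = 1.
Proof. by rewrite -exprD addnn -signr_odd odd_double. Qed.

Let c_mon a S : c a * clifford_monomial c S * c a = chi a S *: clifford_monomial c S.
Proof.
suff H s : uniq s -> c a * (\prod_(b <- s) c b) =
    (-1) ^+ (size s + (a \in s)) *: ((\prod_(b <- s) c b) * c a).
  rewrite H ?enum_uniq // -cardE mem_enum mxAl -mulrA c_sqr mulr1 //.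
elim: s => [_|b s IH /andP[bs us]]; first by rewrite big_nil mul1r mulr1 scale1r.
rewrite big_cons inE; have {IH} := IH us; have [->|ne] := eqVneq a b => /= e.
  rewrite mulrA c_sqr mul1r e (negbTE bs) addn0 mxAl scalerA -exprD.
  by rewrite -mulrA c_sqr mulr1 addn1 !addSn addnn -signr_odd /= negbK odd_double scale1r.
rewrite mulrA c_anti // mulNr -!mulrA e mxAr -scaleNr addSn exprS.
by rewrite mulN1r.
Qed.

Lemma clifford_monomial_unit S : clifford_monomial c S \in unitmx.
Proof.
rewrite /clifford_monomial; elim: (enum S) => [|a s IH].
  by rewrite big_nil unitmx1.
rewrite big_cons; rewrite -[_ * _]/(c a *m _) unitmx_mul IH andbT.
by have [] := @mulmx1_unit _ _ (c a) (c a) (c_sqr a).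
Qed.

Let proj S (s : seq 'I_(2 * n)) (X : 'M[C]_(2 ^ n)) :=
  foldr (fun a Y => Y + chi a S *: (c a * Y * c a)) X s.

Let projE S s f : proj S s (clifford_of c f) =
  \sum_T (gcoef T f * \prod_(a <- s) (1 + chi a S * chi a T)) *: clifford_monomial c T.
Proof.
elim: s => [|a s IH] /=.
  by apply: eq_bigr => T _; rewrite big_nil mulr1.
rewrite IH mulr_sumr mulr_suml scaler_sumr -big_split; apply: eq_bigr => T _ /=.
rewrite mxAr mxAl c_mon big_cons !scalerA -scalerDl; congr (_ *: _).
by ring.
Qed.

Let chi_sep S T : (forall a, chi a S = chi a T) -> S = T.
Proof.
move=> e; have o a : odd (#|S| + (a \in S)) = odd (#|T| + (a \in T)).
  have := e a; rewrite /chi -signr_odd -[RHS]signr_odd => /eqP.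
  by rewrite (inj_eq signr_inj) => /eqP.
have [eo|neo] := eqVneq (odd #|S|) (odd #|T|).
  apply/setP => a; have := o a; rewrite !oddD eo => /addbI.
  by rewrite !oddb.
have TS : T = ~: S.
  apply/setP => a; rewrite inE; have := o a; rewrite !oddD !oddb; move: neo.
  by case: (odd #|S|); case: (odd #|T|); case: (a \in S); case: (a \in T).
have : odd (#|S| + #|~: S|) = false by rewrite cardsC card_ord mul2n odd_double.
by move: neo; rewrite TS oddD; case: (odd #|S|); case: (odd _).
Qed.

Lemma clifford_of_inj : injective (clifford_of c).
Proof.
apply: raddf_inj => f f0; apply: gcoefP => S.
rewrite [RHS](linear0 (gcoef S)).
have := projE S (enum 'I_(2 * n)) f; rewrite f0.
have -> : proj S (enum 'I_(2 * n)) 0 = 0.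
  by elim: (enum _) => //= a s ->; rewrite mulr0 mul0r scaler0 addr0.
rewrite (bigD1 S) //= [X in _ + X]big1 ?addr0 => [|T neTS].
  have -> : \prod_(a <- enum 'I_(2 * n)) (1 + chi a S * chi a S) =
            \prod_(a <- enum 'I_(2 * n)) (2 : C).
    by apply: eq_bigr => a _; rewrite chi_sqr.
  move=> /(congr1 (fun Y => Y *m invmx (clifford_monomial c S))).
  rewrite mul0mx -scalemxAl mulmxV ?clifford_monomial_unit // scalemx1.
  have lt0 : (0 < 2 ^ n)%N by rewrite expn_gt0.
  move=> /matrixP/(_ (Ordinal lt0) (Ordinal lt0)); rewrite !mxE eqxx mulr1n.
  move/esym/eqP; rewrite mulf_eq0 => /orP[/eqP//|]; rewrite prodf_seq_eq0.
  by move=> /hasP[a _ /=]; rewrite pnatr_eq0.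
have [a nea] : exists a, chi a S != chi a T.
  apply/existsP; apply: contra_neqT neTS => /existsPn h.
  by apply/esym/chi_sep => a; apply/eqP; rewrite -[_ == _]negbK h.
apply/eqP; rewrite scaler_eq0 mulf_eq0 prodf_seq_eq0; apply/orP; left.
apply/orP; right; apply/hasP; exists a; rewrite ?mem_enum //=.
move: nea; rewrite /chi -signr_odd -[X in _ != X]signr_odd (inj_eq signr_inj).
rewrite -signr_odd -[X in _ * X]signr_odd.
by case: odd; case: odd => //= _; rewrite ?expr0 ?expr1 ?mulr1 ?mul1r subrr.
Qed.

Lemma clifford_of_lker0 : lker (linfun (clifford_of c)) == 0%VS.
Proof. by apply/lker0P => f g; rewrite !lfunE /=; apply: clifford_of_inj. Qed.

Lemma clifford_ofK : cancel (clifford_of c) (grassmann_rep c).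
Proof. by move=> f; have := lker0_lfunK clifford_of_lker0 f; rewrite lfunE. Qed.

Lemma grassmann_repK : cancel (grassmann_rep c) (clifford_of c).
Proof.
suff img : limg (linfun (clifford_of c)) = fullv.
  move=> X; have := limg_lfunVK (_ : X \in limg (linfun (clifford_of c))).
  by rewrite lfunE; apply; rewrite img memvf.
apply/eqP; rewrite eqEdim subvf limg_dim_eq ?(eqP clifford_of_lker0) ?capv0 //.
rewrite !dimvf /dim /= -[#|{set _}|]cardsT -powersetT card_powerset cardsT card_ord.
by rewrite muln1 mulnn -expnM mulnC leqnn.
Qed.

Lemma grassmann_rep_monomial S :
  grassmann_rep c (clifford_monomial c S) = \prod_(a <- enum S) gvar C a.
Proof. by rewrite gprod_enum -clifford_of_basis clifford_ofK. Qed.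

End Isomorphism.

(* The 6n anticommuting variables theta_a, eta_a, mu_a. *)
Local Notation G := (grassmann C ((2 * n + 2 * n) + 2 * n)).
Definition theta_idx (a : 'I_(2 * n)) : 'I_((2 * n + 2 * n) + 2 * n) :=
  lshift (2 * n) (lshift (2 * n) a).
Definition eta_idx (a : 'I_(2 * n)) : 'I_((2 * n + 2 * n) + 2 * n) :=
  lshift (2 * n) (rshift (2 * n) a).
Definition mu_idx (a : 'I_(2 * n)) : 'I_((2 * n + 2 * n) + 2 * n) :=
  rshift (2 * n + 2 * n) a.
Definition theta : 'cV[G]_(2 * n) := \col_a gvar C (theta_idx a).
Definition eta : 'cV[G]_(2 * n) := \col_a gvar C (eta_idx a).
Definition mu : 'cV[G]_(2 * n) := \col_a gvar C (mu_idx a).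

(* \int Deta = \int deta_{2n} ... \int deta_1, and likewise for mu. *)
Definition int_eta (f : G) : G := berezin [seq eta_idx a | a <- enum 'I_(2 * n)] f.
Definition int_mu (f : G) : G := berezin [seq mu_idx a | a <- enum 'I_(2 * n)] f.

Definition gaussian_action (A B D : 'M[C]_(2 * n)) : G :=
  ('i / 2) *: gquad (col_mx theta eta) (block_mx A B (- B^T) D).

Definition gaussian_map c (E : 'M[C]_(2 ^ n) -> 'M[C]_(2 ^ n)) (C0 : C)
    (A B D : 'M[C]_(2 * n)) : Prop :=
  forall X, gsubst (grassmann_rep c (E X)) theta =
    C0 *: int_eta (int_mu
            (gexp (gaussian_action A B D + 'i *: gdot eta mu) *
             gsubst (grassmann_rep c X) mu)).

Definition gaussian_operator c X (M : 'M[C]_(2 * n)) : Prop :=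
  [/\ \tr X != 0, M^T = - M &
      exists CX : C, grassmann_rep c X =
        CX *: gexp (('i / 2) *: gquad (\col_a gvar C a) M)].

Definition trace_preserving (E : 'M[C]_(2 ^ n) -> 'M[C]_(2 ^ n)) : Prop :=
  forall X, \tr (E X) = \tr X.

Definition bistochastic (E : 'M[C]_(2 ^ n) -> 'M[C]_(2 ^ n)) : Prop :=
  trace_preserving E /\ E 1%:M = 1%:M.

End FermionicGaussian.

(* Main.v *)
From HB Require Import structures.
Require Import Defs.
From mathcomp Require Import all_boot all_order all_algebra.
From mathcomp Require Import reals complex ring.

Set Implicit Arguments.
Unset Strict Implicit.
Unset Printing Implicit Defensive.

Import Order.TTheory GRing.Theory Num.Theory.
Local Open Scope ring_scope.

(* With zeta = B^T theta one has S(theta,eta) + i eta^T mu =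
   (i/2) theta^T A theta + (i/2) eta^T D eta + i eta^T (mu - zeta).  If D = 0, the
   exponential e of this action is an eigenfunction of each d/d eta_a, with
   eigenvalue i (mu_a - zeta_a), so integrating over eta multiplies e by the
   Grassmann delta function prod_a (mu_a - zeta_a); modulo that product mu may be
   replaced by zeta, which gives
     E(X)(theta) = C exp((i/2) theta^T A theta) X(B^T theta).
   Conversely, since Tr X = 2^n X(0), trace preservation says that
     L(X) := C int exp((i/2) eta^T D eta + i eta^T mu) X(mu) Deta Dmu = X(0)
   for all X.  Extending L linearly over the theta variables and applying it to
   exp(-i theta^T mu), the delta function prod_a (eta_a - theta_a) yields
   C exp((i/2) theta^T D theta) = 1, whence C = 1 and D = 0. *)

(** * Grassmann algebra and Berezin integration *)

Section Grassmann.
Variables (F : numFieldType) (N : nat).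
Local Notation G := (grassmann F N).
Implicit Types (f g h v w : G) (i j : 'I_N) (S T U : {set 'I_N}).

(** Ordered monomials span and are products of generators. This induction lets identities be derived
    from the recursive rule [gderivM] alone, without the explicit signs of the monomial basis. *)
Lemma grassmann_ind (P : G -> Prop) :
  P 0 -> (forall f g, P f -> P g -> P (f + g)) ->
  (forall a f, P f -> P (a *: f)) -> P 1 ->
  (forall j f, P f -> P (gvar F j * f)) -> forall f, P f.
Proof.
move=> P0 PD PZ P1 PM f; rewrite [f]grassmannE.
elim/big_ind: _ => // S _; apply: PZ; rewrite -gprod_enum.
by elim: (enum S) => [|j s IH]; rewrite ?big_nil // big_cons; apply: PM.
Qed.

Lemma gderivC i j f : gderiv i (gderiv j f) = - gderiv j (gderiv i f).
Proof.
elim/grassmann_ind: f => [|f g IHf IHg|a f IH||k f IH].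
- by rewrite !linear0 ?oppr0.
- by rewrite !(linearD (gderiv _)) /= IHf IHg opprD.
- by rewrite !gderivZ IH scalerN.
- by rewrite !gderiv1 !linear0 ?oppr0.
rewrite !gderivM !(linearB (gderiv _)) /= !gderivZ !gderivM IH mulrN.
by rewrite !opprD !opprK addrCA addrA.
Qed.

Lemma berezinD s f g : berezin s (f + g) = berezin s f + berezin s g.
Proof. by rewrite /berezin; elim: s f g => //= i s IH f g; rewrite linearD IH. Qed.

Lemma berezinZ s a f : berezin s (a *: f) = a *: berezin s f.
Proof. by rewrite /berezin; elim: s f => //= i s IH f; rewrite linearZ IH. Qed.

HB.instance Definition _ s := GRing.isLinear.Build F G G _ (@berezin F N s)
  (fun a f g => etrans (berezinD s _ _) (congr1 (+%R^~ _) (berezinZ s a f))).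

Lemma gderiv_berezin i s f :
  gderiv i (berezin s f) = (-1) ^+ size s *: berezin s (gderiv i f).
Proof.
elim: s f => [|j s IH] f /=; first by rewrite scale1r.
by rewrite IH gderivC linearN /= exprS mulN1r scaleNr scalerN.
Qed.

Lemma berezinC s t f :
  berezin s (berezin t f) = (-1) ^+ (size s * size t) *: berezin t (berezin s f).
Proof.
elim: s f => [|i s IH] f /=; first by rewrite scale1r.
by rewrite gderiv_berezin linearZ /= IH scalerA -exprD mulSn.
Qed.

Lemma gderiv_berezin0 i s f : gderiv i f = 0 -> gderiv i (berezin s f) = 0.
Proof. by move=> f0; rewrite gderiv_berezin f0 linear0 scaler0. Qed.

(** The homogeneous elements of degree one. They anticommute and square to zero like the generators,
    so they may be substituted for anticommuting variables. *)
Definition glinear v := exists a : 'I_N -> F, v = \sum_j a j *: gvar F j.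

Lemma glinear_gvar j : glinear (gvar F j).
Proof.
exists (fun k => (k == j)%:R); rewrite (bigD1 j) //= eqxx scale1r big1 ?addr0 //.
by move=> k /negbTE->; rewrite scale0r.
Qed.

Lemma glinear0 : glinear 0.
Proof. by exists (fun=> 0); rewrite big1 // => j _; rewrite scale0r. Qed.

Lemma glinearD v w : glinear v -> glinear w -> glinear (v + w).
Proof.
move=> [a ->] [b ->]; exists (fun j => a j + b j); rewrite -big_split.
by apply: eq_bigr => j _; rewrite scalerDl.
Qed.

Lemma glinearZ a v : glinear v -> glinear (a *: v).
Proof.
move=> [b ->]; exists (fun j => a * b j); rewrite scaler_sumr.
by apply: eq_bigr => j _; rewrite scalerA.
Qed.

Lemma glinearB v w : glinear v -> glinear w -> glinear (v - w).
Proof. by move=> lv lw; rewrite -scaleN1r; apply/glinearD/glinearZ. Qed.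

Lemma glinear_sum (I : finType) (x : I -> G) :
  (forall a, glinear (x a)) -> glinear (\sum_a x a).
Proof.
by move=> lx; elim/big_ind: _ => // [|v w]; [apply: glinear0|apply: glinearD].
Qed.

Lemma glinear_anticomm v w : glinear v -> glinear w -> v * w = - (w * v).
Proof.
move=> [a ->] [b ->]; rewrite mulr_suml mulr_sumr -sumrN; apply: eq_bigr => j _.
rewrite mulr_sumr mulr_suml -sumrN; apply: eq_bigr => k _.
by rewrite -!scalerAl -!scalerAr gvarM_anticomm !scalerN !scalerA mulrC.
Qed.

Lemma glinear_sqr0 v : glinear v -> v * v = 0.
Proof.
move=> lv; have := glinear_anticomm lv lv => /eqP.
rewrite -subr_eq0 opprK -mulr2n -scaler_nat scaler_eq0 pnatr_eq0 /=.
by move/eqP.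
Qed.

Lemma gderiv_gvar i j : gderiv i (gvar F j) = (i == j)%:R.
Proof.
by rewrite -[gvar F j]mulr1 gderivM gderiv1 mulr0 subr0 scaler_nat.
Qed.

Lemma gderiv_linearM i v f : glinear v ->
  gderiv i (v * f) = gderiv i v * f - v * gderiv i f.
Proof.
move=> [a ->]; rewrite mulr_suml !(linear_sum (gderiv i)) /= !mulr_suml -sumrB.
apply: eq_bigr => j _; rewrite -!scalerAl !gderivZ gderivM gderiv_gvar -!scalerAl.
by rewrite -scalerBr mulr_natl scaler_nat.
Qed.

Lemma gderiv_linear_scalar i v : glinear v -> exists a : F, gderiv i v = a%:A.
Proof.
move=> [a ->]; exists (a i); rewrite (linear_sum (gderiv i)) (bigD1 i) //= big1 ?addr0.
  by rewrite gderivZ gderiv_gvar eqxx.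
by move=> j ne; rewrite gderivZ gderiv_gvar eq_sym (negbTE ne) scaler0.
Qed.

Lemma glinear_mulr_prod (I : eqType) (x : I -> G) v s :
  (forall a, glinear (x a)) -> glinear v ->
  (\prod_(a <- s) x a) * v = (-1) ^+ size s *: (v * \prod_(a <- s) x a).
Proof.
move=> lx lv; elim: s => [|a s IH]; first by rewrite big_nil mul1r mulr1 scale1r.
rewrite big_cons -mulrA IH -scalerAr (mulrA (x a)) (glinear_anticomm (lx a) lv) mulNr.
by rewrite -mulrA exprS mulN1r scalerN scaleNr.
Qed.

(** The repeated factor can be moved next to its copy. With [x a] a difference of two variables,
    this says that the product of differences acts as a delta function identifying them. *)
Lemma glinear_prod_kill (I : eqType) (x : I -> G) s a :
  (forall b, glinear (x b)) -> a \in s -> (\prod_(b <- s) x b) * x a = 0.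
Proof.
move=> lx as_; rewrite glinear_mulr_prod // (_ : _ * _ = 0) ?scaler0 //.
elim: s as_ => // b s IH; rewrite inE big_cons mulrA => /orP[/eqP->|/IH e].
  by rewrite glinear_sqr0 ?mul0r.
by rewrite (glinear_anticomm (lx a) (lx b)) mulNr -mulrA e mulr0 oppr0.
Qed.

(* Modulo p, the variables y may be replaced by z. *)
Lemma eqmod_prod (I : Type) (x y : I -> G) p s :
  (forall a, glinear (x a)) -> (forall a, glinear (y a)) ->
  (forall a, p * x a = p * y a) ->
  p * \prod_(a <- s) x a = p * \prod_(a <- s) y a.
Proof.
move=> lx ly; elim: s p => [|a s IH] p e; first by rewrite !big_nil.
(* The induction hypothesis is used with [p * y a] in place of [p]; its premise follows by
   anticommuting [y a] to the right. *)
rewrite !big_cons !mulrA e; apply: IH => b.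
rewrite -!mulrA (glinear_anticomm (ly a) (lx b)) (glinear_anticomm (ly a) (ly b)).
by rewrite !mulrN !mulrA e.
Qed.

(** Instead of a parity grading, evenness is encoded by its two useful consequences: centrality and
    a Leibniz rule without sign. *)
Definition geven f := (forall g, f * g = g * f) /\
  (forall i g, gderiv i (f * g) = gderiv i f * g + f * gderiv i g).

Lemma geven1 : geven 1.
Proof.
by split=> [g|i g]; [rewrite mul1r mulr1|rewrite gderiv1 mul0r add0r !mul1r].
Qed.

Lemma gevenD f g : geven f -> geven g -> geven (f + g).
Proof.
move=> [cf df] [cg dg]; split=> [h|i h]; first by rewrite mulrDl mulrDr cf cg.
by rewrite mulrDl !(linearD (gderiv i)) /= df dg !mulrDl addrACA.
Qed.

Lemma gevenZ a f : geven f -> geven (a *: f).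
Proof.
move=> [cf df]; split=> [h|i h]; first by rewrite -scalerAl -scalerAr cf.
by rewrite -scalerAl !gderivZ df scalerDr -!scalerAl.
Qed.

Lemma geven0 : geven 0.
Proof. by rewrite -(scale0r 1); apply: gevenZ geven1. Qed.

Lemma geven_sum I (r : seq I) (P : pred I) (E : I -> G) :
  (forall a, geven (E a)) -> geven (\sum_(a <- r | P a) E a).
Proof.
by move=> ev; elim/big_ind: _ => // [|f g]; [apply: geven0|apply: gevenD].
Qed.

Lemma gevenM f g : geven f -> geven g -> geven (f * g).
Proof.
move=> [cf df] [cg dg]; split=> [h|i h]; first by rewrite -mulrA (cg h) !mulrA (cf h).
by rewrite -mulrA !df dg mulrDr mulrDl !mulrA addrA.
Qed.

Lemma gevenX f m : geven f -> geven (f ^+ m).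
Proof.
by move=> ef; elim: m => [|m IH]; [apply: geven1|rewrite exprS; apply: gevenM].
Qed.

Lemma geven_exp f : geven f -> geven (gexp f).
Proof. by move=> ef; apply: geven_sum => k; apply/gevenZ/gevenX. Qed.

(** A generator, or a derivative, that passes both factors picks up two signs, which cancel. *)
Lemma geven_linearM v w : glinear v -> glinear w -> geven (v * w).
Proof.
move=> lv lw; split=> [g|i g].
  elim/grassmann_ind: g => [|f g IHf IHg|a f IH||k f IH].
  - by rewrite mulr0 mul0r.
  - by rewrite mulrDl mulrDr IHf IHg.
  - by rewrite -scalerAl -scalerAr IH.
  - by rewrite mulr1 mul1r.
  have lk := glinear_gvar k.
  rewrite -[RHS]mulrA -IH !mulrA; congr (_ * f); rewrite -mulrA (glinear_anticomm lw lk).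
  by rewrite mulrN mulrA (glinear_anticomm lv lk) mulNr opprK.
rewrite -mulrA !gderiv_linearM // !mulrBr opprB mulrBl !mulrA.
by rewrite addrA addrAC.
Qed.

Lemma gderivX i f m : geven f -> gderiv i (f ^+ m.+1) = m.+1%:R *: (gderiv i f * f ^+ m).
Proof.
move=> [cf df]; elim: m => [|m IH]; first by rewrite expr0 mulr1 scale1r expr1.
rewrite exprS df IH -scalerAr mulrA cf -mulrA -exprS -{1}[_ * _]scale1r -scalerDl.
by rewrite nat1r.
Qed.

(** The filtration by degree. It is multiplicative and trivial beyond degree [N], which is the
    source of all nilpotency arguments about [gexp]. *)
Definition gdeg_ge (m : nat) f := forall S, (#|S| < m)%N -> gcoef S f = 0.

Lemma gdeg_geM m1 m2 f g : gdeg_ge m1 f -> gdeg_ge m2 g -> gdeg_ge (m1 + m2) (f * g).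
Proof.
move=> df dg S lt; rewrite [_ * _]/(gmul _ _) gcoefM big1 // => T _; rewrite big1 // => U _.
rewrite /gsign; case: ifPn => dTU; last by rewrite mulr0 mul0r.
have [eS|] := eqVneq S (T :|: U); last by rewrite mulr0.
have := lt; rewrite eS cardsU (_ : T :&: U = set0); last by apply/eqP; rewrite setI_eq0.
rewrite cards0 subn0 => lt'.
have [/df->|leT] := ltnP #|T| m1; first by rewrite !mul0r.
have [/dg->|leU] := ltnP #|U| m2; first by rewrite mulr0 !mul0r.
by have := leq_ltn_trans (leq_add leT leU) lt'; rewrite ltnn.
Qed.

Lemma gdeg_geX m f p : gdeg_ge m f -> gdeg_ge (p * m) (f ^+ p).
Proof. by move=> df; elim: p => // p IH; rewrite exprS mulSn; apply: gdeg_geM. Qed.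

Lemma gdeg_ge_eq0 m f : (N < m)%N -> gdeg_ge m f -> f = 0.
Proof.
move=> lt df; apply: gcoefP => S; rewrite df ?linear0 //.
by apply: (leq_ltn_trans (max_card _)); rewrite card_ord.
Qed.

Lemma gdeg_geD m f g : gdeg_ge m f -> gdeg_ge m g -> gdeg_ge m (f + g).
Proof. by move=> df dg S lt; rewrite gcoefD df // dg // addr0. Qed.

Lemma gdeg_geZ m a f : gdeg_ge m f -> gdeg_ge m (a *: f).
Proof. by move=> df S lt; rewrite gcoefZ df // mulr0. Qed.

Lemma gdeg_ge0 m : gdeg_ge m 0.
Proof. by move=> S _; rewrite linear0. Qed.

Lemma gdeg_ge_sum m I (r : seq I) (P : pred I) (E : I -> G) :
  (forall a, gdeg_ge m (E a)) -> gdeg_ge m (\sum_(a <- r | P a) E a).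
Proof.
by move=> dE; elim/big_ind: _ => // [|f g]; [apply: gdeg_ge0|apply: gdeg_geD].
Qed.

Lemma gdeg_geW m1 m2 f : (m1 <= m2)%N -> gdeg_ge m2 f -> gdeg_ge m1 f.
Proof. by move=> le df S lt; apply/df/(leq_trans lt). Qed.

Lemma glinear_deg v : glinear v -> gdeg_ge 1 v.
Proof.
move=> [a ->]; apply: gdeg_ge_sum => j; apply: gdeg_geZ => S.
rewrite ltnS leqn0 cards_eq0 => /eqP->; rewrite gcoef_basis.
by rewrite eq_sym -cards_eq0 cards1.
Qed.

Definition gquadratic f := geven f /\ gdeg_ge 2 f.

Lemma gquadraticD f g : gquadratic f -> gquadratic g -> gquadratic (f + g).
Proof. by move=> [? ?] [? ?]; split; [apply: gevenD|apply: gdeg_geD]. Qed.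

Lemma gquadraticZ a f : gquadratic f -> gquadratic (a *: f).
Proof. by move=> [? ?]; split; [apply: gevenZ|apply: gdeg_geZ]. Qed.

Lemma gquadraticM v w : glinear v -> glinear w -> gquadratic (v * w).
Proof.
move=> lv lw; split; first exact: geven_linearM.
by apply: (@gdeg_geM 1 1); apply: glinear_deg.
Qed.

Lemma gquadratic_sum (I : finType) (E : I -> G) :
  (forall a, gquadratic (E a)) -> gquadratic (\sum_a E a).
Proof.
by move=> qE; split; [apply: geven_sum|apply: gdeg_ge_sum] => a; case: (qE a).
Qed.

(** Powers beyond [N] vanish by degree. A free truncation order is what allows exponentials in
    algebras with different numbers of generators to be compared. *)
Lemma gexp_trunc K f : (N < K)%N -> gdeg_ge 1 f ->
  gexp f = \sum_(k < K) (k`!%:R)^-1 *: f ^+ k.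
Proof.
move=> lt df; rewrite /gexp (big_ord_widen_cond K xpredT (fun k => (k`!%:R)^-1 *: f ^+ k)) //.
rewrite big_mkcond /=; apply: eq_bigr => k _; case: ifPn => //; rewrite -leqNgt => lek.
rewrite (_ : f ^+ k = 0) ?scaler0 //; apply: (gdeg_ge_eq0 lek).
by have := gdeg_geX (p := k) df; rewrite muln1.
Qed.

Lemma gexp0 : gexp (0 : G) = 1.
Proof.
rewrite /gexp big_ord_recl expr0 fact0 invr1 scale1r big1 ?addr0 // => k _.
by rewrite expr0n /= scaler0.
Qed.

Lemma gderiv_exp i f : gquadratic f -> gderiv i (gexp f) = gderiv i f * gexp f.
Proof.
move=> [ef df]; have lt : (0 < N)%N by case: (N) i => [[]|].
(* Differentiating the Taylor polynomial of order [N] leaves powers up to [N - 1] only, so the term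
   with [f ^+ N] on the right must vanish. Its degree is at least [2N], and [N] is positive because
   [i] exists. *)
have z : f ^+ N = 0.
  apply: (gdeg_ge_eq0 _ (gdeg_geX (p := N) df)).
  by rewrite muln2 -addnn -addn1 leq_add2l.
rewrite /gexp linear_sum mulr_sumr big_ord_recl [RHS]big_ord_recr /=.
rewrite linearZ /= expr0 gderiv1 scaler0 add0r z scaler0 mulr0 addr0.
apply: eq_bigr => k _; rewrite linearZ /= gderivX // scalerA -scalerAr.
rewrite factS natrM invfM mulrC mulrA divff ?mul1r //.
by rewrite pnatr_eq0.
Qed.

(** The Cauchy product: the binomial theorem applies because [f] is central, and the terms of the
    product with total exponent above [N] vanish by degree. *)
Lemma gexpD f g : gquadratic f -> gquadratic g -> gexp (f + g) = gexp f * gexp g.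
Proof.
move=> [ef df] [_ dg]; have [cf _] := ef.
pose E a b : G := ((a`!%:R)^-1 *: f ^+ a) * ((b`!%:R)^-1 *: g ^+ b).
have E0 a b : (N < a + b)%N -> E a b = 0.
  move=> lt; rewrite /E -scalerAl -scalerAr (_ : f ^+ a * g ^+ b = 0) ?scaler0 //.
  apply: (gdeg_ge_eq0 lt); apply: gdeg_geM.
    by have := gdeg_geX (p := a) (gdeg_geW (isT : (1 <= 2)%N) df); rewrite muln1.
  by have := gdeg_geX (p := b) (gdeg_geW (isT : (1 <= 2)%N) dg); rewrite muln1.
transitivity (\sum_(k < N.+1) \sum_(a < k.+1) E a (k - a)%N).
  apply: eq_bigr => k _; rewrite addrC exprDn_comm; last by rewrite /GRing.comm cf.
  rewrite scaler_sumr; apply: eq_bigr => a _.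
  rewrite /E -scalerAl -scalerAr scalerA -scaler_nat scalerA.
  have [cfa _] := gevenX a ef; rewrite cfa; congr (_ *: _).
  have le : (a <= k)%N by rewrite -ltnS.
  have := bin_fact le => /(congr1 (fun m => m%:R : F)); rewrite !natrM => <-.
  by field; rewrite !pnatr_eq0 -!lt0n bin_gt0 le !fact_gt0.
have -> : gexp f * gexp g = \sum_(a < N.+1) \sum_(b < N.+1) E a b.
  by rewrite mulr_suml; apply: eq_bigr => a _; rewrite mulr_sumr.
rewrite [RHS]pair_bigA /= [RHS](bigID (fun ab : 'I_N.+1 * 'I_N.+1 => ab.1 + ab.2 < N.+1)%N) /=.
rewrite [X in _ = _ + X]big1 ?addr0; last first.
  by move=> ab; rewrite -leqNgt => /E0.
under [LHS]eq_bigr => k _ do rewrite (big_ord_widen_cond N.+1 xpredT (fun a => E a (k - a)%N)) //.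
rewrite pair_big_dep /=.
(* The reindexing of the triangle: a pair of exponents [(a, b)] corresponds to the total exponent
   and [a]. *)
pose h (ab : 'I_N.+1 * 'I_N.+1) : 'I_N.+1 * 'I_N.+1 := (inord (ab.1 + ab.2), ab.1).
pose h' (ka : 'I_N.+1 * 'I_N.+1) : 'I_N.+1 * 'I_N.+1 := (ka.2, inord (ka.1 - ka.2)).
rewrite (reindex_onto h h') /= => [|[k a] /=]; last first.
  rewrite ltnS => le; have lt : (k - a < N.+1)%N by rewrite (leq_ltn_trans (leq_subr _ _)).
  by congr pair; apply: val_inj; rewrite /= !inordK ?subnKC.
have lea a b : (a + b < N.+1)%N -> (inord (a + b) : 'I_N.+1) = (a + b)%N :> nat.
  by move=> lt; rewrite inordK.
have hK (a b : 'I_N.+1) : (a + b < N.+1)%N ->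
    (a < (inord (a + b) : 'I_N.+1).+1)%N && (h' (h (a, b)) == (a, b)).
  move=> lt; rewrite lea // ltnS leq_addr /h' /h /= xpair_eqE eqxx /=.
  by rewrite lea // -val_eqE /= addKn inordK.
apply: eq_big => [[a b]|[a b]] /=; last first.
  case/andP; rewrite /h' /h /= xpair_eqE eqxx /= => _ /eqP/(congr1 val) /=.
  by rewrite [X in X = _ -> _]inordK ?(leq_ltn_trans (leq_subr _ _)) // => ->.
have [/hK //|le] := ltnP (a + b) N.+1.
apply/negbTE/negP; rewrite /h' /h /= xpair_eqE eqxx /=.
(* Outside the triangle [inord] takes its default value [ord0]; the remaining conditions would then
   force [a] and [b] to be 0, against [N < a + b]. *)
have -> : (inord (a + b) : 'I_N.+1) = ord0.
  by rewrite /inord /insubd insubF // ltnNge le.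
rewrite ltnS leqn0 sub0n => /andP[/eqP a0 /eqP b0].
by move: le; rewrite a0 -b0 inordK.
Qed.

Lemma gcoef0_linearM v f : glinear v -> gcoef set0 (v * f) = 0.
Proof.
move=> lv; apply: (gdeg_geM (m2 := 0) (glinear_deg lv)); last by rewrite cards0.
by move=> S; rewrite ltn0.
Qed.

Lemma gcoef0_1 : gcoef set0 (1 : G) = 1.
Proof. by rewrite gcoef_basis eqxx. Qed.

Lemma gcoef0M f g : gcoef set0 (f * g) = gcoef set0 f * gcoef set0 g.
Proof.
elim/grassmann_ind: f => [|f1 f2 IH1 IH2|a f IH||j f IH].
- by rewrite mul0r linear0 mul0r.
- by rewrite mulrDl !gcoefD IH1 IH2 mulrDl.
- by rewrite -scalerAl !gcoefZ IH mulrA.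
- by rewrite mul1r gcoef0_1 mul1r.
by rewrite -mulrA !gcoef0_linearM ?mul0r //; apply: glinear_gvar.
Qed.

Lemma gcoef0_exp f : gdeg_ge 1 f -> gcoef set0 (gexp f) = 1.
Proof.
move=> df; rewrite gcoef_sum big_ord_recl gcoefZ expr0 gcoef0_1 fact0 invr1 mulr1.
rewrite big1 ?addr0 // => k _.
by rewrite gcoefZ exprS gcoef0M df ?cards0 // mul0r mulr0.
Qed.

(** Power by power: after one factor [f] is replaced by [g], centrality of [g] moves it past the
    other factors, to which the induction hypothesis applies. *)
Lemma eqmod_exp p f g : geven g -> p * f = p * g -> p * gexp f = p * gexp g.
Proof.
move=> [cg _] e; rewrite !mulr_sumr; apply: eq_bigr => k _; rewrite -!scalerAr.
congr (_ *: _); elim: (k : nat) => // m IH.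
by rewrite exprS mulrA e -mulrA cg mulrA IH -mulrA -exprSr.
Qed.

(** * Berezin integrals of eigenfunctions and Grassmann delta functions *)

Lemma berezin_linearM s v f : glinear v -> (forall i, i \in s -> gderiv i v = 0) ->
  berezin s (v * f) = (-1) ^+ size s *: (v * berezin s f).
Proof.
move=> lv; elim: s f => [|i s IH] f dv /=; first by rewrite scale1r.
rewrite gderiv_linearM // dv ?mem_head // mul0r sub0r linearN /= IH => [|j js].
  by rewrite exprS mulN1r scaleNr.
by rewrite dv // inE js orbT.
Qed.

(** Each derivative produces a factor [k *: v a], which is then pulled out of the remaining
    derivatives with one sign for each; the exponents [0 + 1 + ... + (size s - 1)] add up to the
    binomial coefficient. *)
Lemma berezin_eigen (I : eqType) (y : I -> 'I_N) (v : I -> G) (k : F) e s :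
  (forall a, glinear (v a)) -> (forall a b, gderiv (y a) (v b) = 0) ->
  (forall a, gderiv (y a) e = k *: (v a * e)) ->
  berezin [seq y a | a <- s] e =
    ((-1) ^+ 'C(size s, 2) * k ^+ size s) *: ((\prod_(a <- s) v a) * e).
Proof.
move=> lv dv de; elim: s => [|a s IH] /=; first by rewrite big_nil mul1r !expr0 mulr1 scale1r.
rewrite de linearZ /= berezin_linearM // => [|_ /mapP[b _ ->]//].
rewrite IH size_map -scalerAr !scalerA big_cons; congr (_ *: _); last by rewrite mulrA.
by rewrite binS bin1 exprD exprS; ring.
Qed.

Lemma gderiv_prod0 (I : eqType) (w : I -> G) s i f :
  (forall a, glinear (w a)) -> (forall a, a \in s -> gderiv i (w a) = 0) ->
  gderiv i f = 0 -> gderiv i ((\prod_(a <- s) w a) * f) = 0.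
Proof.
move=> lw dw df; elim: s dw => [|a s IH] dw; first by rewrite big_nil mul1r.
rewrite big_cons -mulrA gderiv_linearM // dw ?mem_head // mul0r IH ?mulr0 ?subr0 //.
by move=> b bs; rewrite dw // inE bs orbT.
Qed.

(** When the derivative in [x a] acts, the factor with index [a] stands in front and nothing behind
    it depends on [x a]; exactly this factor is removed, without sign. *)
Lemma berezin_delta (I : eqType) (x : I -> 'I_N) (z : I -> G) f s :
  injective x -> (forall a, glinear (z a)) -> (forall a b, gderiv (x a) (z b) = 0) ->
  (forall a, gderiv (x a) f = 0) -> uniq s ->
  berezin [seq x a | a <- s] ((\prod_(a <- s) (gvar F (x a) - z a)) * f) = f.
Proof.
move=> xI lz dz df; have lw a : glinear (gvar F (x a) - z a).
  by apply: glinearB => //; apply: glinear_gvar.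
have dw a b : gderiv (x a) (gvar F (x b) - z b) = (a == b)%:R.
  by rewrite linearB /= gderiv_gvar dz subr0 (inj_eq xI).
elim: s => [|a s IH] /=; first by rewrite big_nil mul1r.
move=> /andP[as_ us]; rewrite big_cons -mulrA gderiv_linearM // dw eqxx mul1r.
rewrite gderiv_prod0 // ?mulr0 ?subr0 ?IH // => b bs; rewrite dw.
by case: eqP bs as_ => // -> ->.
Qed.

(** The binomial coefficient is [m (2m - 1)], of the same parity as [m], while [k ^+ (2 * m)] is the
    [m]-th power of -1. Hence Gaussian integrals over an even number of variables carry no
    constant. *)
Lemma gauss_sign (k : F) m : k ^+ 2 = -1 ->
  (-1) ^+ 'C(2 * m, 2) * k ^+ (2 * m) = 1.
Proof.
move=> k2; elim: m => [|m IH]; first by rewrite muln0 !expr0 mulr1.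
have: (-1) ^+ (2 * m) = 1 :> F by rewrite mul2n -signr_odd odd_double.
rewrite mulnS add2n; move: (2 * m)%N IH => q IH e.
have -> : k ^+ q.+2 = - k ^+ q by rewrite !exprS mulrA -expr2 k2 mulN1r.
by rewrite -[RHS]IH !binS !bin1 bin0 !exprD e; ring.
Qed.

(** The common core of [gaussian_integral] and [gaussian_fourier]. Integration over [y] multiplies
    [e] by the delta function of [x - z]; the last premise then replaces [e] by its value [f] at
    [x = z], and integration over [x] removes the delta function. *)
Lemma berezin_gauss_delta m (x y : 'I_(2 * m) -> 'I_N) (z : 'I_(2 * m) -> G) (k : F) e f :
  k ^+ 2 = -1 -> injective x -> (forall a, glinear (z a)) ->
  (forall a b, y a != x b) ->
  (forall a b, gderiv (y a) (z b) = 0) -> (forall a b, gderiv (x a) (z b) = 0) ->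
  (forall a, gderiv (y a) e = k *: ((gvar F (x a) - z a) * e)) ->
  (forall a, gderiv (x a) f = 0) ->
  (forall p, (forall a, p * gvar F (x a) = p * z a) -> p * e = p * f) ->
  berezin [seq x a | a <- enum 'I_(2 * m)]
    (berezin [seq y a | a <- enum 'I_(2 * m)] e) = f.
Proof.
move=> k2 xI lz yx dyz dxz de df ep.
have lw a : glinear (gvar F (x a) - z a).
  by apply: glinearB => //; apply: glinear_gvar.
rewrite (berezin_eigen _ lw _ de) => [|a b]; last first.
  by rewrite linearB /= gderiv_gvar dyz (negbTE (yx a b)) subr0.
rewrite size_enum_ord gauss_sign // scale1r ep ?berezin_delta ?enum_uniq // => a.
apply/eqP; rewrite -subr_eq0 -mulrBr.
by rewrite (glinear_prod_kill (x := fun a => gvar F (x a) - z a)) ?mem_enum.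
Qed.

End Grassmann.

(** * Substitution and quadratic forms *)

Section Substitution.
Variables (F : numFieldType) (N m : nat).
Local Notation G := (grassmann F N).
Implicit Types (f g : grassmann F m) (x y z : 'cV[G]_m) (p : G) (S : {set 'I_m}).

Lemma gsubstD x f g : gsubst (f + g) x = gsubst f x + gsubst g x.
Proof. by rewrite -big_split; apply: eq_bigr => S _; rewrite gcoefD scalerDl. Qed.

Lemma gsubstZ x a f : gsubst (a *: f) x = a *: gsubst f x.
Proof. by rewrite scaler_sumr; apply: eq_bigr => S _; rewrite gcoefZ scalerA. Qed.

Lemma gsubst0 x : gsubst 0 x = 0.
Proof. by rewrite -(scale0r 0) gsubstZ scale0r. Qed.

Lemma gsubst_sum x I (r : seq I) (P : pred I) (E : I -> grassmann F m) :
  gsubst (\sum_(i <- r | P i) E i) x = \sum_(i <- r | P i) gsubst (E i) x.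
Proof. exact: (big_morph _ (gsubstD x) (gsubst0 x)). Qed.

Lemma gsubst_basis x S : gsubst (gbasis F S) x = \prod_(a <- enum S) x a 0.
Proof.
rewrite /gsubst (bigD1 S) //= gcoef_basis eqxx scale1r [X in _ + X]big1 ?addr0 // => T ne.
by rewrite gcoef_basis (negbTE ne) scale0r.
Qed.

Lemma gsubst1 x : gsubst 1 x = 1.
Proof. by rewrite gsubst_basis enum_set0 big_nil. Qed.

(** Both sides are strictly increasing lists with the same elements. The splitting exhibits the
    position of [j], hence the sign for moving it there. *)
Lemma enum_setU1_split S j : j \notin S ->
  enum (j |: S) = enum [set k in S | (k < j)%N] ++ j :: enum [set k in S | (j < k)%N]
  /\ enum S = enum [set k in S | (k < j)%N] ++ enum [set k in S | (j < k)%N].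
Proof.
move=> nS; have tr : transitive (fun i j : 'I_m => (i < j)%N).
  by move=> ? ? ?; apply: ltn_trans.
have irr : irreflexive (fun i j : 'I_m => (i < j)%N) by move=> ?; rewrite ltnn.
have sE := @sorted_enum_set m.
have lt1 : all (fun k : 'I_m => (k < j)%N) (enum [set k in S | (k < j)%N]).
  by apply/allP => k; rewrite mem_enum inE => /andP[].
have lt2 : all (fun k : 'I_m => (j < k)%N) (enum [set k in S | (j < k)%N]).
  by apply/allP => k; rewrite mem_enum inE => /andP[].
have lt12 : allrel (fun i j : 'I_m => (i < j)%N)
    (enum [set k in S | (k < j)%N]) (enum [set k in S | (j < k)%N]).
  apply/allrelP => a b /(allP lt1) la /(allP lt2); exact: ltn_trans.
split; apply: (irr_sorted_eq tr irr) => //.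
- rewrite sorted_pairwise // pairwise_cat /= allrel_consr lt1 lt12 lt2.
  by rewrite -!sorted_pairwise // !sE.
- move=> k; rewrite mem_enum mem_cat inE !(mem_enum, inE).
  rewrite -val_eqE; case: (ltngtP k j) => [lt|lt|/val_inj->] /=.
  - by rewrite andbT andbF !orbF.
  - by rewrite andbT andbF.
  - by rewrite (negbTE nS).
- by rewrite sorted_pairwise // pairwise_cat lt12 -!sorted_pairwise // !sE.
move=> k; rewrite mem_enum mem_cat !(mem_enum, inE).
case: (ltngtP k j) => [lt|lt|/val_inj->]; rewrite ?andbT ?andbF ?orbF //=.
by apply/negbTE.
Qed.

(** On a monomial without [j], moving [x j 0] to its sorted position costs the same sign as moving
    the generator; on a monomial containing [j] both sides vanish. Multiplicativity of substitution
    follows from this. *)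
Lemma gsubst_gvarM x j f : (forall a, glinear (x a 0)) ->
  gsubst (gvar F j * f) x = x j 0 * gsubst f x.
Proof.
move=> lx; rewrite [f]grassmannE mulr_sumr !gsubst_sum mulr_sumr; apply: eq_bigr => S _.
rewrite -scalerAr !gsubstZ -scalerAr; congr (_ *: _); rewrite gvarM_basis gsubst_basis.
case: ifPn => jS.
  rewrite gsubst0; have := glinear_prod_kill lx (_ : j \in enum S).
  rewrite mem_enum => /(_ jS); rewrite glinear_mulr_prod // => /eqP.
  by rewrite scaler_eq0 signr_eq0 => /eqP.
have [e1 e2] := enum_setU1_split jS; rewrite gsubstZ gsubst_basis e1 e2.
rewrite !big_cat big_cons /= !mulrA glinear_mulr_prod // -cardE -scalerAl scalerA -exprD.
by rewrite addnn -signr_odd odd_double scale1r.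
Qed.

Lemma gsubst_gvar x j : (forall a, glinear (x a 0)) -> gsubst (gvar F j) x = x j 0.
Proof. by move=> lx; rewrite -[gvar F j]mulr1 gsubst_gvarM // gsubst1 mulr1. Qed.

Lemma gsubstM x f g : (forall a, glinear (x a 0)) ->
  gsubst (f * g) x = gsubst f x * gsubst g x.
Proof.
move=> lx; elim/grassmann_ind: f => [|f1 f2 IH1 IH2|a f IH||j f IH].
- by rewrite mul0r gsubst0 mul0r.
- by rewrite mulrDl !gsubstD IH1 IH2 mulrDl.
- by rewrite -scalerAl !gsubstZ IH scalerAl.
- by rewrite mul1r gsubst1 mul1r.
by rewrite -mulrA !gsubst_gvarM // IH mulrA.
Qed.

Lemma gsubstX x f k : (forall a, glinear (x a 0)) ->
  gsubst (f ^+ k) x = gsubst f x ^+ k.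
Proof.
by move=> lx; elim: k => [|k IH]; rewrite ?gsubst1 // !exprS gsubstM // IH.
Qed.

Lemma gcoef0_gsubst x f : (forall a, glinear (x a 0)) ->
  gcoef set0 (gsubst f x) = gcoef set0 f.
Proof.
move=> lx; rewrite gcoef_sum (bigD1 set0) //= enum_set0 big_nil gcoefZ gcoef0_1.
rewrite mulr1 big1 ?addr0 // => S /set0Pn[a aS]; rewrite gcoefZ.
have : a \in enum S by rewrite mem_enum.
by case: (enum S) => // b s _; rewrite big_cons gcoef0_linearM ?mulr0.
Qed.

Lemma gsubst_exp x f : (forall a, glinear (x a 0)) -> gdeg_ge 1 f ->
  gsubst (gexp f) x = gexp (gsubst f x).
Proof.
(* The two exponentials are Taylor polynomials of orders [m] and [N]; both are extended to order
   [m + N]. *)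
move=> lx df; rewrite (@gexp_trunc _ _ (m + N).+1) // ?ltnS ?leq_addr //.
rewrite [RHS](@gexp_trunc _ _ (m + N).+1) ?ltnS ?leq_addl //; last first.
  by move=> S; rewrite ltnS leqn0 cards_eq0 => /eqP->; rewrite gcoef0_gsubst // df ?cards0.
by rewrite gsubst_sum; apply: eq_bigr => k _; rewrite gsubstZ gsubstX.
Qed.

Lemma gsubst_quad x k (v : 'cV[grassmann F m]_k) (M : 'M[F]_k) :
  (forall a, glinear (x a 0)) ->
  gsubst (gquad v M) x = gquad (\col_a gsubst (v a 0) x) M.
Proof.
move=> lx; rewrite gsubst_sum; apply: eq_bigr => a _; rewrite gsubst_sum.
by apply: eq_bigr => b _; rewrite gsubstZ gsubstM // !mxE.
Qed.

Lemma gderiv_gsubst0 x f i : (forall a, glinear (x a 0)) ->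
  (forall a, gderiv i (x a 0) = 0) -> gderiv i (gsubst f x) = 0.
Proof.
move=> lx dx; rewrite linear_sum big1 // => S _; rewrite linearZ /=.
by rewrite -[\prod_(_ <- _) _]mulr1 gderiv_prod0 ?scaler0 // gderiv1.
Qed.

Lemma eqmod_gsubst x y p f : (forall a, glinear (x a 0)) -> (forall a, glinear (y a 0)) ->
  (forall a, p * x a 0 = p * y a 0) -> p * gsubst f x = p * gsubst f y.
Proof.
move=> lx ly e; rewrite !mulr_sumr; apply: eq_bigr => S _.
by rewrite -!scalerAr (eqmod_prod (x := fun a => x a 0) (y := fun a => y a 0)).
Qed.

End Substitution.

(** * Quadratic and bilinear forms in Grassmann variables *)

Section QuadraticForms.
Variables (F : numFieldType) (N m : nat).
Local Notation G := (grassmann F N).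
Implicit Types (x y z : 'cV[G]_m) (M : 'M[F]_m) (p : G).

Lemma gquadratic_gquad x M : (forall a, glinear (x a 0)) -> gquadratic (gquad x M).
Proof.
move=> lx; apply: gquadratic_sum => a; apply: gquadratic_sum => b.
exact/gquadraticZ/gquadraticM.
Qed.

Lemma gquadratic_gdot x y : (forall a, glinear (x a 0)) ->
  (forall a, glinear (y a 0)) -> gquadratic (gdot x y).
Proof. by move=> lx ly; apply: gquadratic_sum => a; apply: gquadraticM. Qed.

Lemma gquadDr x M1 M2 : gquad x (M1 + M2) = gquad x M1 + gquad x M2.
Proof.
rewrite -big_split; apply: eq_bigr => a _; rewrite -big_split; apply: eq_bigr => b _.
by rewrite mxE scalerDl.
Qed.

Lemma gquad0 x : gquad x 0 = 0.
Proof. by rewrite /gquad big1 // => a _; rewrite big1 // => b _; rewrite mxE scale0r. Qed.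

Lemma eqmod_gquad x y p M : (forall a, glinear (x a 0)) -> (forall a, glinear (y a 0)) ->
  (forall a, p * x a 0 = p * y a 0) -> p * gquad x M = p * gquad y M.
Proof.
move=> lx ly e; rewrite !mulr_sumr; apply: eq_bigr => a _.
rewrite !mulr_sumr; apply: eq_bigr => b _; rewrite -!scalerAr.
have := eqmod_prod [:: a; b] lx ly e.
by rewrite !big_cons !big_nil !mulr1 => ->.
Qed.

(** The two terms of the signed Leibniz rule agree after exchanging indices, because the
    antisymmetry of [M] compensates the sign; this gives the factor 2. *)
Lemma gderiv_gquad i x M : M^T = - M -> (forall a, glinear (x a 0)) ->
  gderiv i (gquad x M) = 2 *: \sum_a \sum_b M a b *: (gderiv i (x a 0) * x b 0).
Proof.
move=> aM lx; rewrite linear_sum /=.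
have dE a : gderiv i (\sum_b M a b *: (x a 0 * x b 0)) =
   \sum_b M a b *: (gderiv i (x a 0) * x b 0) + \sum_b M b a *: (gderiv i (x b 0) * x a 0).
  rewrite linear_sum -big_split; apply: eq_bigr => b _ /=.
  rewrite gderivZ gderiv_linearM // scalerBr; congr (_ + _).
  have -> : M b a = - M a b by move/matrixP/(_ a b): aM; rewrite !mxE.
  have [k ->] := gderiv_linear_scalar i (lx b).
  by rewrite -scalerAr -scalerAl mulr1 mul1r scaleNr.
rewrite (eq_bigr _ (fun a _ => dE a)) big_split /= [X in _ + X]exchange_big /=.
by rewrite -mulr2n scaler_nat.
Qed.

Lemma gderiv_gquad0 i x M : (forall a, glinear (x a 0)) ->
  (forall a, gderiv i (x a 0) = 0) -> gderiv i (gquad x M) = 0.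
Proof.
move=> lx dx; rewrite linear_sum big1 // => a _; rewrite linear_sum big1 // => b _.
by rewrite /= gderivZ gderiv_linearM // !dx mul0r mulr0 subr0 scaler0.
Qed.

Lemma gderiv_gdot i x y : (forall a, glinear (x a 0)) ->
  gderiv i (gdot x y) = \sum_a (gderiv i (x a 0) * y a 0 - x a 0 * gderiv i (y a 0)).
Proof.
by move=> lx; rewrite linear_sum; apply: eq_bigr => a _ /=; rewrite gderiv_linearM.
Qed.

(** Applied to the transpose of the matrix of a Gaussian map, this is the origin of the rule sending
    [M] to [B *m M *m B^T]. *)
Lemma gquad_mul k x (B : 'M[F]_(k, m)) (M : 'M[F]_k) :
  gquad (\col_a \sum_b B a b *: x b 0) M = gquad x (B^T *m M *m B).
Proof.
transitivity (\sum_a \sum_b \sum_c \sum_d (B a c * M a b * B b d) *: (x c 0 * x d 0)).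
  apply: eq_bigr => a _; apply: eq_bigr => b _; rewrite !mxE mulr_suml scaler_sumr.
  apply: eq_bigr => c _; rewrite mulr_sumr scaler_sumr; apply: eq_bigr => d _.
  rewrite -scalerAl -scalerAr !scalerA; congr (_ *: _); ring.
rewrite (eq_bigr _ (fun a _ => exchange_big _ _ _ _ _ _)) exchange_big /=.
apply: eq_bigr => c _.
rewrite (eq_bigr _ (fun a _ => exchange_big _ _ _ _ _ _)) exchange_big /=.
apply: eq_bigr => d _; rewrite -[in RHS]mulmxA mxE scaler_suml.
apply: eq_bigr => a _; rewrite !mxE mulr_sumr scaler_suml.
by apply: eq_bigr => b _; rewrite mulrA.
Qed.

End QuadraticForms.

Section EvenBerezin.
Variables (F : numFieldType) (N : nat).
Local Notation G := (grassmann F N).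
Implicit Types (f v : G) (s : seq 'I_N).

Lemma berezin_linearM_even s v f : glinear v -> ~~ odd (size s) ->
  (forall i, i \in s -> gderiv i v = 0) -> berezin s (v * f) = v * berezin s f.
Proof.
by move=> lv os dv; rewrite berezin_linearM // -signr_odd (negbTE os) scale1r.
Qed.

Lemma gsubst_at0 m (f : grassmann F m) : gsubst f (0 : 'cV[G]_m) = (gcoef set0 f)%:A.
Proof.
rewrite /gsubst (bigD1 set0) //= enum_set0 big_nil [X in _ + X]big1 ?addr0 //.
move=> S /set0Pn[a aS]; have : a \in enum S by rewrite mem_enum.
by case: (enum S) => // b s _; rewrite big_cons mxE mul0r scaler0.
Qed.

End EvenBerezin.

(** * Traces of Clifford monomials *)

Section Trace.
Variables (C : numClosedFieldType) (n : nat).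
Variables (c : 'I_(2 * n) -> 'M[C]_(2 ^ n)) (cP : clifford_generators c).

Lemma clifford_sqr a : c a * c a = 1.
Proof.
have [_ /(_ a a)] := cP; rewrite eqxx mulr1 => e.
have n2 : (2 : C) != 0 by rewrite pnatr_eq0.
by apply: (scalerI n2); rewrite scaler_nat mulr2n [LHS]e -scalemx1.
Qed.

Lemma clifford_anticomm a b : a != b -> c a * c b = - (c b * c a).
Proof.
have [_ /(_ a b)] := cP; move=> + /negbTE ne; rewrite ne mulr0 raddf0 => /addr0_eq e.
by rewrite -[c b * c a]e opprK.
Qed.

Lemma clifford_mulr_prod a s : uniq s -> (\prod_(b <- s) c b) * c a =
  (-1) ^+ (size s + (a \in s)) *: (c a * \prod_(b <- s) c b).
Proof.
elim: s => [|b s IH /andP[bs us]]; first by rewrite big_nil mul1r mulr1 scale1r.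
rewrite big_cons inE -mulrA IH // -[LHS]/(c b *m (_ *: (c a *m _))) -scalemxAr.
have [->|ne] /= := eqVneq a b.
  by rewrite (negbTE bs) addn0 addn1 !exprS !mulN1r opprK.
rewrite eq_sym in ne; rewrite -[c b *m _]/(c b * (c a * _)) mulrA (clifford_anticomm ne).
by rewrite mulNr addSn exprS mulN1r scaleNr scalerN mulrA.
Qed.

(** Provides a generator anticommuting with the monomial of [S]. If [#|S|] is even, any member of
    [S] works; if it is odd, [S] is not the whole set of [2n] indices and any index outside
    works. *)
Lemma exists_odd_card_mem (S : {set 'I_(2 * n)}) : S != set0 ->
  exists a, odd (#|S| + (a \in S)).
Proof.
move=> S0; have [oS|eS] := boolP (odd #|S|); last first.
  by have [a aS] := set0Pn _ S0; exists a; rewrite aS addn1 /= eS.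
have [a aS] : exists a, a \notin S.
  apply/existsP; apply: contraLR oS => /existsPn h.
  have -> : S = setT by apply/setP => a; rewrite inE; apply/negPn/h.
  by rewrite cardsT card_ord oddM.
by exists a; rewrite (negbTE aS) addn0.
Qed.

(** Inserting the square of a generator that anticommutes with the monomial and using cyclicity of
    the trace shows that the trace equals its own opposite. *)
Lemma tr_clifford_monomial S : S != set0 -> \tr (clifford_monomial c S) = 0.
Proof.
move=> /exists_odd_card_mem[a oa]; set M := clifford_monomial c S.
have Ma : M * c a = - (c a * M).
  rewrite /M /clifford_monomial clifford_mulr_prod ?enum_uniq // mem_enum -cardE.
  by rewrite -signr_odd oa scaleN1r.
have tM : \tr M = - \tr M.
  rewrite -{1}[M]mulr1 -(clifford_sqr a) mulrA Ma mulNr raddfN; congr (- _).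
  by rewrite -mulrA [LHS](mxtrace_mulC (c a) (M * c a)) -[_ *m _]/(_ * _) -mulrA clifford_sqr mulr1.
have /eqP : \tr M *+ 2 = 0 by rewrite mulr2n {1}tM addNr.
by rewrite mulrn_eq0 /= => /eqP.
Qed.

Lemma tr_clifford_of f : \tr (clifford_of c f) = (2 ^ n)%:R * gcoef set0 f.
Proof.
rewrite raddf_sum (bigD1 set0) //= [X in _ + X]big1 ?addr0 => [|S S0].
  by rewrite mxtraceZ /clifford_monomial enum_set0 big_nil mxtrace1 mulrC.
by rewrite mxtraceZ tr_clifford_monomial ?mulr0.
Qed.

Lemma tr_grassmann_rep X : \tr X = (2 ^ n)%:R * gcoef set0 (grassmann_rep c X).
Proof. by rewrite -tr_clifford_of (grassmann_repK cP). Qed.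

End Trace.

(** * Gaussian integrals *)

Section ThetaEtaMu.
Variables (C : numClosedFieldType) (n : nat).
Local Notation G := (grassmann C ((2 * n + 2 * n) + 2 * n)).
Local Notation theta := (theta C n).
Local Notation eta := (eta C n).
Local Notation mu := (mu C n).
Implicit Types (A B D : 'M[C]_(2 * n)) (f : grassmann C (2 * n)).

Definition zeta B : 'cV[G]_(2 * n) := \col_a \sum_b B^T a b *: theta b 0.

Lemma glinear_theta a : glinear (theta a 0).
Proof. by rewrite mxE; apply: glinear_gvar. Qed.

Lemma glinear_eta a : glinear (eta a 0).
Proof. by rewrite mxE; apply: glinear_gvar. Qed.

Lemma glinear_mu a : glinear (mu a 0).
Proof. by rewrite mxE; apply: glinear_gvar. Qed.

Lemma glinear_zeta B a : glinear (zeta B a 0).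
Proof. by rewrite mxE; apply: glinear_sum => b; apply/glinearZ/glinear_theta. Qed.

#[local] Hint Resolve glinear_theta glinear_eta glinear_mu glinear_zeta : core.

Lemma theta_idx_inj : injective (@theta_idx n).
Proof. by move=> a b /lshift_inj/lshift_inj. Qed.

Lemma eta_idx_inj : injective (@eta_idx n).
Proof. by move=> a b /lshift_inj/rshift_inj. Qed.

Lemma mu_idx_inj : injective (@mu_idx n).
Proof. by move=> a b /rshift_inj. Qed.

Lemma idx_neq (a b : 'I_(2 * n)) :
  ((theta_idx a == eta_idx b) = false) * ((eta_idx a == theta_idx b) = false) *
  ((theta_idx a == mu_idx b) = false) * ((mu_idx a == theta_idx b) = false) *
  ((eta_idx a == mu_idx b) = false) * ((mu_idx a == eta_idx b) = false).
Proof.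
by rewrite /theta_idx /eta_idx /mu_idx !(inj_eq (@lshift_inj _ _)) !eq_shift.
Qed.

Lemma gderiv_var (a b : 'I_(2 * n)) :
  (gderiv (theta_idx a) (theta b 0) = (a == b)%:R) *
  (gderiv (eta_idx a) (eta b 0) = (a == b)%:R) *
  (gderiv (mu_idx a) (mu b 0) = (a == b)%:R) *
  (gderiv (theta_idx a) (eta b 0) = 0) * (gderiv (eta_idx a) (theta b 0) = 0) *
  (gderiv (theta_idx a) (mu b 0) = 0) * (gderiv (mu_idx a) (theta b 0) = 0) *
  (gderiv (eta_idx a) (mu b 0) = 0) * (gderiv (mu_idx a) (eta b 0) = 0).
Proof.
rewrite !mxE !gderiv_gvar !idx_neq.
by rewrite (inj_eq theta_idx_inj) (inj_eq eta_idx_inj) (inj_eq mu_idx_inj).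
Qed.

Lemma gderiv_zeta B (a b : 'I_(2 * n)) :
  (gderiv (eta_idx a) (zeta B b 0) = 0) * (gderiv (mu_idx a) (zeta B b 0) = 0).
Proof.
by split; rewrite !mxE linear_sum big1 // => d _; rewrite /= gderivZ gderiv_var scaler0.
Qed.

Lemma gdotBr (x y z : 'cV[G]_(2 * n)) : gdot x (y - z) = gdot x y - gdot x z.
Proof. by rewrite -sumrB; apply: eq_bigr => a _; rewrite !mxE mulrBr. Qed.

Lemma mu_zetaE B a : (mu - zeta B) a 0 = mu a 0 - zeta B a 0.
Proof. by rewrite [LHS]mxE [X in _ + X]mxE. Qed.

(** Since theta and eta anticommute, the two off-diagonal blocks contribute the same term
    [- gdot eta (zeta B)]; their sum, times ['i / 2], shifts [mu] by [zeta B] in the coupling with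
    [eta]. *)
Lemma gaussian_actionE A B D : gaussian_action A B D + 'i *: gdot eta mu =
  ('i / 2) *: gquad theta A + ('i / 2) *: gquad eta D + 'i *: gdot eta (mu - zeta B).
Proof.
have n2 : (2 : C) != 0 by rewrite pnatr_eq0.
have -> : gaussian_action A B D = ('i / 2) *: (gquad theta A + gquad eta D
    - 2 *: gdot eta (zeta B)).
  rewrite /gaussian_action; congr (_ *: _); rewrite /gquad big_split_ord /=.
  rewrite (eq_bigr (fun a => \sum_b A a b *: (theta a 0 * theta b 0) +
      \sum_b B a b *: (theta a 0 * eta b 0))) => [|a _]; last first.
    by rewrite big_split_ord /=; congr (_ + _); apply: eq_bigr => b _;
      rewrite ?block_mxEul ?block_mxEur ?col_mxEu ?col_mxEd.
  rewrite [X in _ + X](eq_bigr (fun a => \sum_b - B b a *: (eta a 0 * theta b 0) +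
      \sum_b D a b *: (eta a 0 * eta b 0))) => [|a _]; last first.
    by rewrite big_split_ord /=; congr (_ + _); apply: eq_bigr => b _;
      rewrite ?block_mxEdl ?block_mxEdr ?col_mxEu ?col_mxEd ?mxE.
  have e1 : \sum_a \sum_b B a b *: (theta a 0 * eta b 0) = - gdot eta (zeta B).
    rewrite exchange_big -sumrN; apply: eq_bigr => b _ /=.
    rewrite [zeta B b 0]mxE mulr_sumr -sumrN; apply: eq_bigr => a _.
    by rewrite [B^T _ _]mxE -scalerAr (glinear_anticomm (glinear_theta a) (glinear_eta b)) scalerN.
  have e2 : \sum_a \sum_b - B b a *: (eta a 0 * theta b 0) = - gdot eta (zeta B).
    rewrite -sumrN; apply: eq_bigr => a _ /=.
    rewrite [zeta B a 0]mxE mulr_sumr -sumrN; apply: eq_bigr => b _.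
    by rewrite [B^T _ _]mxE -scalerAr scaleNr.
  rewrite (big_split _ _ _ (fun a => \sum_b A a b *: _)).
  rewrite (big_split _ _ _ (fun a => \sum_b - B b a *: _)) /=.
  rewrite [X in _ + X + _ = _]e1 [X in _ + (X + _) = _]e2.
  rewrite scaler_nat mulr2n opprD.
  by rewrite [X in _ + X = _]addrC addrACA.
rewrite gdotBr !scalerBr scalerA divfK // !scalerDr -!addrA.
by congr (_ + (_ + _)); rewrite addrC.
Qed.

Lemma size_idx (idx : 'I_(2 * n) -> 'I_((2 * n + 2 * n) + 2 * n)) :
  size [seq idx a | a <- enum 'I_(2 * n)] = (2 * n)%N.
Proof. by rewrite size_map size_enum_ord. Qed.

Lemma int_etaC (f : G) : int_eta (int_mu f) = int_mu (int_eta f).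
Proof.
by rewrite /int_eta /int_mu berezinC !size_idx -signr_odd oddM oddM scale1r.
Qed.

Lemma gaussian_integral A B f :
  int_eta (int_mu (gexp (gaussian_action A B 0 + 'i *: gdot eta mu) * gsubst f mu)) =
  gexp (('i / 2) *: gquad theta A) * gsubst f (zeta B).
Proof.
(* The eta integral is performed first; the exchange is free of sign because there are [2n]
   variables of each kind. *)
rewrite int_etaC gaussian_actionE gquad0 scaler0 addr0.
set QA := _ *: gquad theta A.
have qA : gquadratic QA by apply/gquadraticZ/gquadratic_gquad.
have lw a : glinear ((mu - zeta B) a 0).
  by rewrite mu_zetaE; apply: glinearB.
have qw : gquadratic ('i *: gdot eta (mu - zeta B)).
  exact/gquadraticZ/gquadratic_gdot.
have qQ := gquadraticD qA qw.
have dA a : gderiv (eta_idx a) QA = 0 /\ gderiv (mu_idx a) QA = 0.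
  by split; rewrite gderivZ gderiv_gquad0 ?scaler0 // => b; rewrite gderiv_var.
apply: (@berezin_gauss_delta _ _ _ (@mu_idx n) (@eta_idx n) (fun a => zeta B a 0) 'i).
- exact: sqrCi.
- exact: mu_idx_inj.
- exact: glinear_zeta.
- by move=> a b; rewrite idx_neq.
- by move=> a b; rewrite gderiv_zeta.
- by move=> a b; rewrite gderiv_zeta.
(* The eigenvalue equation: only the summand with index [a] of the coupling depends on [eta_a]. *)
- move=> a; have [_ ->] := geven_exp qQ.1; rewrite gderiv_gsubst0 // => [|b]; last first.
    by rewrite gderiv_var.
  rewrite mulr0 addr0 gderiv_exp // linearD /= (dA a).1 add0r gderivZ -!scalerAl.
  congr (_ *: _); rewrite -mulrA; congr (_ * _).
  rewrite gderiv_gdot // (bigD1 a) //= big1 => [|b ne].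
    rewrite gderiv_var eqxx mul1r mu_zetaE linearB /= gderiv_var gderiv_zeta.
    by rewrite subr0 mulr0 subr0 addr0 [mu a 0]mxE.
  rewrite gderiv_var eq_sym (negbTE ne) mul0r.
  rewrite (_ : gderiv _ _ = 0) ?mulr0 ?subr0 //.
  by rewrite mu_zetaE linearB /= gderiv_var gderiv_zeta subr0.
- move=> a; have [_ ->] := geven_exp qA.1; rewrite gderiv_exp // (dA a).2 mul0r mul0r add0r.
  by rewrite gderiv_gsubst0 ?mulr0 // => b; rewrite gderiv_zeta.
(* Modulo [p], the coupling term vanishes and the operator's polynomial is evaluated at [zeta B]. *)
move=> p ep; have {}ep a : p * mu a 0 = p * zeta B a 0 by rewrite [mu a 0]mxE ep.
rewrite !mulrA (eqmod_exp (g := QA) qA.1).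
  have [cA _] := geven_exp qA.1; move: (gexp QA) cA => e cA.
  by rewrite -(mulrA p) cA -(mulrA p) cA !mulrA (eqmod_gsubst _ _ _ ep).
rewrite mulrDr (_ : p * ('i *: _) = 0) ?addr0 //.
rewrite -scalerAr mulr_sumr big1 ?scaler0 // => a _.
rewrite (glinear_anticomm (glinear_eta a) (lw a)) mulrN mulrA.
by rewrite mu_zetaE mulrBr ep subrr mul0r oppr0.
Qed.

(** Here [mu] occurs only linearly in the exponent, paired with [eta - theta], so the mu integral
    produces the delta function of this difference. *)
Lemma gaussian_fourier D :
  int_eta (int_mu (gexp (('i / 2) *: gquad eta D + 'i *: gdot eta mu) *
                   gexp (- 'i *: gdot theta mu))) =
  gexp (('i / 2) *: gquad theta D).
Proof.
have qd (x : 'cV[G]_(2 * n)) : (forall a, glinear (x a 0)) -> gquadratic (('i / 2) *: gquad x D).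
  by move=> lx; apply/gquadraticZ/gquadratic_gquad.
have q1 := qd _ glinear_eta; have q1' := qd _ glinear_theta.
have q2 : gquadratic ('i *: gdot eta mu) by apply/gquadraticZ/gquadratic_gdot.
have q3 : gquadratic (- 'i *: gdot theta mu) by apply/gquadraticZ/gquadratic_gdot.
rewrite -(gexpD (gquadraticD q1 q2) q3).
have qQ := gquadraticD (gquadraticD q1 q2) q3.
(* The eigenvalue constant is [- 'i] because the derivative in [mu_a] has to pass [eta_a] or
   [theta_a]. *)
apply: (@berezin_gauss_delta _ _ _ (@eta_idx n) (@mu_idx n) (fun a => theta a 0) (- 'i)).
- by rewrite sqrrN sqrCi.
- exact: eta_idx_inj.
- exact: glinear_theta.
- by move=> a b; rewrite idx_neq.
- by move=> a b; rewrite gderiv_var.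
- by move=> a b; rewrite gderiv_var.
- move=> a; rewrite gderiv_exp // scalerAl; congr (_ * _).
  rewrite !linearD /= !gderivZ gderiv_gquad0 // => [|b]; last by rewrite gderiv_var.
  have dm (x : 'cV[G]_(2 * n)) : (forall b, glinear (x b 0)) -> (forall b, gderiv (mu_idx a) (x b 0) = 0) ->
      gderiv (mu_idx a) (gdot x mu) = - x a 0.
    move=> lx dx; rewrite gderiv_gdot // (bigD1 a) //= big1 => [|b ne].
      by rewrite dx gderiv_var eqxx mul0r mulr1 sub0r addr0.
    by rewrite dx gderiv_var eq_sym (negbTE ne) mul0r mulr0 subr0.
  rewrite !dm // => [|b|b]; rewrite ?gderiv_var // scaler0 add0r.
  by rewrite [eta a 0]mxE scalerN -scaleNr.
- by move=> a; rewrite gderiv_exp // gderivZ gderiv_gquad0 ?scaler0 ?mul0r // => b; rewrite gderiv_var.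
move=> p ep; have {}ep a : p * eta a 0 = p * theta a 0 by rewrite [eta a 0]mxE ep.
apply: eqmod_exp; first exact: q1'.1.
(* Once [eta] is replaced by [theta], the two couplings to [mu] cancel. *)
rewrite !mulrDr -!scalerAr (eqmod_gquad _ glinear_eta glinear_theta ep) -addrA.
rewrite (_ : p * gdot eta mu = p * gdot theta mu); last first.
  by rewrite !mulr_sumr; apply: eq_bigr => a _; rewrite !mulrA ep.
by rewrite scaleNr subrr addr0.
Qed.

End ThetaEtaMu.

(** * Recovering the matrices and the constant from the kernel of a Gaussian map *)

Section GaussianKernel.
Variables (C : numClosedFieldType) (n : nat).
Local Notation G := (grassmann C ((2 * n + 2 * n) + 2 * n)).
Local Notation theta := (theta C n).
Local Notation eta := (eta C n).
Local Notation mu := (mu C n).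
Implicit Types (A B D M : 'M[C]_(2 * n)) (f : grassmann C (2 * n)).

#[local] Hint Resolve glinear_theta glinear_eta glinear_mu glinear_zeta : core.

(** A left inverse is the substitution [y], which sends each theta variable back to its generator
    and the eta and mu variables to 0. *)
Lemma gsubst_theta_inj : injective (fun f => gsubst f theta).
Proof.
pose y : 'cV[grassmann C (2 * n)]_(2 * n + 2 * n + 2 * n) :=
  \col_i if [pick a | theta_idx a == i] is Some a then gvar C a else 0.
have ly i : glinear (y i 0).
  by rewrite mxE; case: pickP => [a _|_]; [apply: glinear_gvar|apply: glinear0].
have yE a : y (theta_idx a) 0 = gvar C a.
  by rewrite mxE; case: pickP => [b /eqP/theta_idx_inj->//|/(_ a)]; rewrite eqxx.
apply: (can_inj (g := fun h : G => gsubst h y)) => f.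
elim/grassmann_ind: f => [|f g IHf IHg|k f IH||j f IH].
- by rewrite !gsubst0.
- by rewrite !gsubstD IHf IHg.
- by rewrite !gsubstZ IH.
- by rewrite !gsubst1.
by rewrite gsubst_gvarM // gsubstM // IH [theta j 0]mxE gsubst_gvar // yE.
Qed.

(** As the exponential is 1, the derivative of the equation in [theta_a] states that the exponent
    itself has zero derivative; a second derivative, in [theta_b], isolates the entry [A a b]. *)
Lemma gexp_gquad_theta_eq1 A : A^T = - A ->
  gexp (('i / 2) *: gquad theta A) = 1 -> A = 0.
Proof.
move=> aA e; have qA : gquadratic (('i / 2) *: gquad theta A).
  exact/gquadraticZ/gquadratic_gquad.
apply/matrixP => a b; rewrite [RHS]mxE.
have := gderiv_exp (theta_idx a) qA; rewrite e gderiv1 mulr1 gderivZ gderiv_gquad //.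
rewrite scalerA divfK ?pnatr_eq0 // => /esym/eqP; rewrite scaler_eq0 (negbTE (neq0Ci _)) /=.
move=> /eqP /(congr1 (gderiv (theta_idx b))); rewrite linear0 linear_sum /=.
rewrite (bigD1 a) //= [X in _ + X]big1 ?addr0 => [|d ne]; last first.
  rewrite big1 ?linear0 // => d' _.
  by rewrite gderiv_var eq_sym (negbTE ne) mul0r scaler0.
rewrite linear_sum (bigD1 b) //= [X in _ + X]big1 ?addr0 => [|d ne]; last first.
  by rewrite gderivZ !gderiv_var eqxx mul1r gderiv_var eq_sym (negbTE ne) scaler0.
rewrite gderivZ gderiv_var eqxx mul1r gderiv_var eqxx => /(congr1 (gcoef set0)).
by rewrite linear0 gcoefZ gcoef0_1 mulr1.
Qed.

(** The product of all theta variables is the delta function at 0, so multiplication by it is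
    injective on elements free of theta. *)
Lemma berezin_theta_delta (f : G) : (forall a : 'I_(2 * n), gderiv (theta_idx a) f = 0) ->
  berezin [seq theta_idx a | a <- enum 'I_(2 * n)]
    ((\prod_(a <- enum 'I_(2 * n)) theta a 0) * f) = f.
Proof.
move=> df; rewrite (eq_bigr (fun a => gvar C (theta_idx a) - 0)) => [|a _]; last first.
  by rewrite mxE subr0.
apply: berezin_delta => //; [exact: theta_idx_inj|move=> _; exact: glinear0| |exact: enum_uniq].
by move=> a b; rewrite linear0.
Qed.

Lemma int_thetaM a (f : G) :
  int_eta (int_mu (theta a 0 * f)) = theta a 0 * int_eta (int_mu f).
Proof.
rewrite /int_eta /int_mu !berezin_linearM_even ?size_idx ?oddM // => i.
  by move=> /mapP[b _ ->]; rewrite gderiv_var.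
by move=> /mapP[b _ ->]; rewrite gderiv_var.
Qed.

Lemma int_theta_prodM (f : G) (p := \prod_(a <- enum 'I_(2 * n)) theta a 0) :
  int_eta (int_mu (p * f)) = p * int_eta (int_mu f).
Proof.
rewrite /p; elim: (enum _) => [|a s IH]; first by rewrite big_nil !mul1r.
by rewrite big_cons -!mulrA int_thetaM IH.
Qed.

Lemma eqmod_mulr (p f g h : G) : p * f = p * g -> p * (f * h) = p * (g * h).
Proof. by rewrite !mulrA => ->. Qed.

(** Such an [L] is linear over theta and evaluates polynomials in [mu] at 0. Every term of the
    exponential except the leading 1 contains some [mu], and is therefore killed. *)
Lemma theta_linear_exp (L : G -> G) (k : C) :
  (forall Y Z, L (Y + Z) = L Y + L Z) -> (forall a Z, L (a *: Z) = a *: L Z) ->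
  (forall a Z, L (theta a 0 * Z) = theta a 0 * L Z) ->
  (forall f, L (gsubst f mu) = (gcoef set0 f)%:A) ->
  L (gexp (k *: gdot theta mu)) = 1.
Proof.
move=> LD LZ Lth Lmu; set P := k *: _.
have L0 : L 0 = 0 by have := LZ 0 0; rewrite !scale0r.
have Lsum := big_morph L LD L0.
have eP : geven P.
  exact: (gquadraticZ _ (gquadratic_gdot (@glinear_theta C n) (@glinear_mu C n))).1.
(* One factor [P] at a time is split: its theta passes through [L] and its mu joins [f]. After one
   such step [f] has no constant term, so a condition on [f] is imposed for [d = 0] only. *)
have key d f : (d = 0%N -> gcoef set0 f = 0) -> L (P ^+ d * gsubst f mu) = 0.
  elim: d f => [|d IH] f f0; first by rewrite mul1r Lmu f0 // scale0r.
  have [cPd _] := gevenX d eP; rewrite exprSr -mulrA.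
  move: (P ^+ d) IH cPd => Pd IH cPd.
  rewrite -scalerAl -scalerAr LZ mulr_suml mulr_sumr Lsum big1 ?scaler0 // => a _.
  rewrite -[X in Pd * X]mulrA -(gsubst_gvarM a f (@glinear_mu C n)) mulrA cPd -mulrA.
  by rewrite Lth IH ?mulr0 // => _; rewrite gcoef0_linearM //; apply: glinear_gvar.
rewrite /gexp Lsum big_ord_recl big1 => [|d _].
  by rewrite fact0 invr1 scale1r expr0 -(gsubst1 mu) Lmu gcoef0_1 scale1r addr0 gsubst1.
by rewrite LZ -[P ^+ _]mulr1 -(gsubst1 mu) key ?scaler0.
Qed.

Section TracePreserving.
Variables (D : 'M[C]_(2 * n)) (C0 : C).
Let Q := ('i / 2) *: gquad eta D + 'i *: gdot eta mu.
Let qQ : gquadratic Q.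
Proof.
by apply: gquadraticD; apply: gquadraticZ; [apply: gquadratic_gquad|apply: gquadratic_gdot].
Qed.

(* Multiplication by theta_1 ... theta_2n sets theta to 0 and is undone by integration over theta. *)
Lemma gaussian_map_gcoef0 A B f g :
  gsubst g theta = C0 *: int_eta (int_mu
     (gexp (gaussian_action A B D + 'i *: gdot eta mu) * gsubst f mu)) ->
  C0 *: int_eta (int_mu (gexp Q * gsubst f mu)) = (gcoef set0 g)%:A.
Proof.
move=> e; pose p := \prod_(a <- enum 'I_(2 * n)) theta a 0.
have p0 a : p * theta a 0 = 0.
  by rewrite /p (glinear_prod_kill (x := fun a => theta a 0)) ?mem_enum.
have p0' a : p * theta a 0 = p * (0 : 'cV[G]_(2 * n)) a 0 by rewrite p0 mxE mulr0.
have l0 a : glinear ((0 : 'cV[G]_(2 * n)) a 0) by rewrite mxE; apply: glinear0.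
(* Modulo [p] theta is 0: the form of [A] and the shift [zeta B] both disappear. *)
have pQ : p * (gaussian_action A B D + 'i *: gdot eta mu) = p * Q.
  rewrite (gaussian_actionE A B D) gdotBr scalerBr !mulrDr -!addrA -[RHS]add0r.
  congr (_ + (_ + _)).
    rewrite -scalerAr (eqmod_gquad _ (@glinear_theta C n) l0 p0') /gquad big1 ?mulr0 ?scaler0 //.
    by move=> a _; rewrite big1 // => b _; rewrite !mxE mul0r scaler0.
  rewrite -[RHS]addr0; congr (_ + _); rewrite mulrN -scalerAr mulr_sumr big1 ?scaler0 ?oppr0 //.
  move=> a _; rewrite (glinear_anticomm (@glinear_eta C n a) (@glinear_zeta C n B a)) mulrN mulrA.
  rewrite [zeta B a 0]mxE mulr_sumr big1 ?mul0r ?oppr0 // => b _.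
  by rewrite -scalerAr p0 scaler0.
have pI (Y : G) : p * (C0 *: int_eta (int_mu Y)) = C0 *: int_eta (int_mu (p * Y)).
  by rewrite -scalerAr int_theta_prodM.
have pE := eqmod_exp qQ.1 pQ.
have ep : p * (C0 *: int_eta (int_mu (gexp Q * gsubst f mu))) = p * (gcoef set0 g)%:A.
  have := eqmod_gsubst g (@glinear_theta C n) l0 p0'; rewrite gsubst_at0 e => <-.
  refine (etrans (pI _) (etrans (congr1 (fun Z => C0 *: int_eta (int_mu Z)) _) (esym (pI _)))).
  exact/eqmod_mulr/esym.
(* Both sides are free of theta, so the factor [p] in [ep] can be removed by integrating over
   theta. *)
have dQ a : gderiv (theta_idx a) (gexp Q * gsubst f mu) = 0.
  have [_ dE] := geven_exp qQ.1; rewrite dE (gderiv_exp _ qQ).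
  have deta b : gderiv (theta_idx a) (eta b 0) = 0 by rewrite gderiv_var.
  have dmu b : gderiv (theta_idx a) (mu b 0) = 0 by rewrite gderiv_var.
  rewrite (gderiv_gsubst0 _ (@glinear_mu C n) dmu) mulr0 addr0.
  suff -> : gderiv (theta_idx a) Q = 0 by rewrite -mulrA mul0r.
  rewrite linearD /= !gderivZ (gderiv_gquad0 _ (@glinear_eta C n) deta).
  rewrite (gderiv_gdot _ _ (@glinear_eta C n)) [X in 'i *: X]big1.
    by rewrite !scaler0 addr0.
  by move=> b _; rewrite deta dmu mul0r mulr0 subr0.
have d1 a : gderiv (theta_idx a) (C0 *: int_eta (int_mu (gexp Q * gsubst f mu))) = 0.
  by rewrite gderivZ (gderiv_berezin0 _ (gderiv_berezin0 _ (dQ a))) scaler0.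
have d2 (a : 'I_(2 * n)) : gderiv (theta_idx a) ((gcoef set0 g)%:A : G) = 0.
  by rewrite gderivZ gderiv1 scaler0.
exact: etrans (esym (berezin_theta_delta d1)) (etrans (congr1 _ ep) (berezin_theta_delta d2)).
Qed.

(** The integral of [gexp (- 'i *: gdot theta mu)] is computed twice: by [gaussian_fourier], and as
    a constant term by [theta_linear_exp]. *)
Lemma gexp_gquad_theta_of_gcoef0 :
  (forall f, C0 *: int_eta (int_mu (gexp Q * gsubst f mu)) = (gcoef set0 f)%:A) ->
  C0 *: gexp (('i / 2) *: gquad theta D) = 1.
Proof.
move=> h; rewrite -gaussian_fourier -/Q.
apply: (theta_linear_exp (L := fun Z => C0 *: int_eta (int_mu (gexp Q * Z)))) => //.
- by move=> Y Z; rewrite mulrDr /int_mu berezinD /int_eta berezinD scalerDr.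
- by move=> k Z; rewrite -scalerAr /int_mu berezinZ /int_eta berezinZ !scalerA mulrC.
have [cQ _] := geven_exp qQ.1; move: (gexp Q) cQ => e cQ a Z.
by rewrite mulrA cQ -mulrA int_thetaM scalerAr.
Qed.

End TracePreserving.

End GaussianKernel.

(** * Gaussian maps *)

Section GaussianMaps.
Variables (C : numClosedFieldType) (n : nat).
Variables (c : 'I_(2 * n) -> 'M[C]_(2 ^ n)) (hc : clifford_generators c).
Variables (E : 'M[C]_(2 ^ n) -> 'M[C]_(2 ^ n)).
Local Notation G := (grassmann C ((2 * n + 2 * n) + 2 * n)).
Local Notation theta := (theta C n).
Implicit Types (A B D M : 'M[C]_(2 * n)) (X : 'M[C]_(2 ^ n)).
Let gvars : 'cV[grassmann C (2 * n)]_(2 * n) := \col_a gvar C a.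

Lemma trace_preservingP : trace_preserving E <->
  forall X, gcoef set0 (grassmann_rep c (E X)) = gcoef set0 (grassmann_rep c X).
Proof.
have p0 : (2 ^ n)%:R != 0 :> C by rewrite pnatr_eq0 expn_eq0.
split=> h X; have := h X; rewrite !(tr_grassmann_rep hc); first by move/(mulfI p0).
by move->.
Qed.

(** The closed form from which traces, the image of the identity and the images of Gaussian
    operators are all read off. *)
Lemma gaussian_map_tpE A B : gaussian_map c E 1 A B 0 -> forall X,
  gsubst (grassmann_rep c (E X)) theta =
  gexp (('i / 2) *: gquad theta A) * gsubst (grassmann_rep c X) (zeta B).
Proof. by move=> hE X; rewrite hE scale1r gaussian_integral. Qed.

Lemma trace_preserving_iff A B D C0 : D^T = - D -> gaussian_map c E C0 A B D ->
  trace_preserving E <-> D = 0 /\ C0 = 1.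
Proof.
move=> hD hE; split=> [/trace_preservingP h|[D0 C1]].
  have e : C0 *: gexp (('i / 2) *: gquad theta D) = 1.
    (* Every polynomial [f] represents an operator, so trace preservation constrains the kernel on
       all of them. *)
    apply: gexp_gquad_theta_of_gcoef0 => f; have := hE (clifford_of c f).
    by move=> /gaussian_map_gcoef0; rewrite h (clifford_ofK hc).
  (* The constant term of [e] gives the constant; what remains says that the exponential is 1, hence
     [D = 0]. *)
  have C1 : C0 = 1.
    have := congr1 (gcoef set0) e; rewrite gcoefZ gcoef0_1 gcoef0_exp ?mulr1 //.
    apply: (@gdeg_geW _ _ 1 2) => //.
    exact: (gquadraticZ _ (gquadratic_gquad _ (@glinear_theta C n))).2.
  by split=> //; apply: gexp_gquad_theta_eq1 => //; rewrite -e C1 scale1r.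
subst D C0; apply/trace_preservingP => X.
have := congr1 (gcoef set0) (gaussian_map_tpE hE X).
rewrite gcoef0M !gcoef0_gsubst; [|exact: glinear_zeta|exact: glinear_theta].
rewrite gcoef0_exp ?mul1r //; apply: (@gdeg_geW _ _ 1 2) => //.
exact: (gquadraticZ _ (gquadratic_gquad _ (@glinear_theta C n))).2.
Qed.

Lemma gsubst_gaussian N (x : 'cV[grassmann C N]_(2 * n)) M k :
  (forall a, glinear (x a 0)) ->
  gsubst (k *: gexp (('i / 2) *: gquad gvars M)) x =
  k *: gexp (('i / 2) *: gquad x M).
Proof.
move=> lx; rewrite gsubstZ; congr (_ *: _).
have lv a : glinear (gvars a 0) by rewrite mxE; apply: glinear_gvar.
rewrite gsubst_exp //; last first.
  apply: (@gdeg_geW _ _ 1 2) => //.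
  exact: (gquadraticZ _ (gquadratic_gquad _ lv)).2.
rewrite gsubstZ (gsubst_quad _ _ lx).
have -> // : \col_a gsubst (gvars a 0) x = x.
by apply/colP => a; rewrite !mxE (gsubst_gvar _ lx).
Qed.

(** In the closed form the two exponentials merge and their quadratic forms add up; the prefactor
    [CX] is unchanged, and trace preservation keeps the trace nonzero. *)
Lemma gaussian_map_gaussian A B M X : A^T = - A -> trace_preserving E ->
  gaussian_map c E 1 A B 0 -> gaussian_operator c X M ->
  gaussian_operator c (E X) (B *m M *m B^T + A).
Proof.
move=> hA tp hE [tX hM [CX eX]]; split; first by rewrite tp.
  by rewrite linearD /= !trmx_mul trmxK hM hA mulmxA mulmxN mulNmx opprD.
exists CX; apply: gsubst_theta_inj => /=.
rewrite (gsubst_gaussian _ _ (@glinear_theta C n)) (gaussian_map_tpE hE) eX.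
rewrite (gsubst_gaussian _ _ (@glinear_zeta C n B)) gquad_mul trmxK -scalerAr.
have q M' : gquadratic (('i / 2) *: gquad theta M').
  exact/gquadraticZ/gquadratic_gquad/glinear_theta.
by rewrite [B *m M *m B^T + A]addrC gquadDr scalerDr (gexpD (q _) (q _)).
Qed.

(** By the closed form, the identity is mapped to the operator represented by the exponential of the
    form of [A], which is 1 exactly when [A = 0]. *)
Lemma bistochastic_iff A B D C0 : A^T = - A -> D^T = - D ->
  gaussian_map c E C0 A B D -> bistochastic E <-> [/\ A = 0, D = 0 & C0 = 1].
Proof.
move=> hA hD hE; have tpP := trace_preserving_iff hD hE.
have rep1 : grassmann_rep c 1%:M = 1.
  rewrite -(clifford_ofK hc 1); congr grassmann_rep.
  by rewrite clifford_of_basis /clifford_monomial enum_set0 big_nil.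
split=> [[/tpP[D0 C1] E1]|[A0 D0 C1]].
  split=> //; subst D C0; apply: gexp_gquad_theta_eq1 => //.
  by have := gaussian_map_tpE hE 1%:M; rewrite E1 rep1 !gsubst1 mulr1.
split; first exact/tpP.
subst A D C0; apply: (can_inj (grassmann_repK hc)); apply: gsubst_theta_inj => /=.
by rewrite (gaussian_map_tpE hE) rep1 !gsubst1 gquad0 scaler0 gexp0 mulr1.
Qed.

End GaussianMaps.

Theorem mainTheorem4 (R : realType) (n : nat)
  (c : 'I_(2 * n) -> 'M[R[i]]_(2 ^ n)) (hc : clifford_generators c)
  (E : 'M[R[i]]_(2 ^ n) -> 'M[R[i]]_(2 ^ n))
  (C : R[i]) (A B D : 'M[R[i]]_(2 * n))
  (hA : A^T = - A) (hD : D^T = - D) (hE : gaussian_map c E C A B D) :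
  ((trace_preserving E <-> D = 0 /\ C = 1) /\
   (trace_preserving E ->
      forall (X : 'M[R[i]]_(2 ^ n)) (M : 'M[R[i]]_(2 * n)),
        gaussian_operator c X M ->
        gaussian_operator c (E X) (B *m M *m B^T + A))) /\
  ((bistochastic E <-> [/\ A = 0, D = 0 & C = 1]) /\
   (bistochastic E ->
      forall (X : 'M[R[i]]_(2 ^ n)) (M : 'M[R[i]]_(2 * n)),
        gaussian_operator c X M ->
        gaussian_operator c (E X) (B *m M *m B^T))).
Proof.
have tpP := trace_preserving_iff hc hD hE; have bsP := bistochastic_iff hc hA hD hE.
split; split; [exact: tpP| |exact: bsP|].
  move=> tp X M; have [D0 C1] := tpP.1 tp; subst D C.
  exact: gaussian_map_gaussian hA tp hE.
move=> bs X M; have [A0 D0 C1] := bsP.1 bs; subst A D C.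
(* The bistochastic rule is the trace-preserving one at [A = 0]. *)
rewrite -[_ *m B^T]addr0; exact: gaussian_map_gaussian hA bs.1 hE.
Qed.
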